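(* Let $\ell_1,\ell_2$ be positive integers and let $(a,b)\in\mathbb{Z}^2$ be a primitive vector lying strictly in the first quadrant. If $\mathsf{T}_1(a,b)=(\ell_1b-a,b)$ lies strictly in the first quadrant, then $$\mathsf{f}_{a,b}=\mathsf{f}_{\mathsf{T}_1(a,b)}.$$ Similarly, if $\mathsf{T}_2(a,b)=(a,\ell_2a-b)$ lies strictly in the first quadrant, then $\mathsf{f}_{a,b}=\mathsf{f}_{\mathsf{T}_2(a,b)}$.
   Context: Tropical vertex group. For a nonzero vector $(a,b)\in\mathbb{Z}^2$ and $f=1+t\,x^ay^b\,g(x^ay^b,t)$ with $g(z,t)\in\mathbb{C}[z][[t]]$, let $\theta_{(a,b),f}$ be the $\mathbb{C}[[t]]$-algebra automorphism of $\mathbb{C}[x,x^{-1},y,y^{-1}][[t]]$ with $\theta_{(a,b),f}(x)=x\cdot f^{-b}$, $\theta_{(a,b),f}(y)=y\cdot f^{a}$. The tropical vertex group $H$ is the completion with respect to $(t)\subset\mathbb{C}[[t]]$ of the subgroup generated by all such elements; infinite products make sense in $H$ when only finitely many factors are nontrivial mod $t^k$ for each $k$. Composition $\circ$ is composition of algebra automorphisms. Let $S_{\ell_1}=\theta_{(1,0),(1+tx)^{\ell_1}}$ and $T_{\ell_2}=\theta_{(0,1),(1+ty)^{\ell_2}}$. There is a unique factorization $$T_{\ell_2}^{-1}\circ S_{\ell_1}\circ T_{\ell_2}\circ S_{\ell_1}^{-1}=\prod^{\rightarrow}\theta_{(a,b),f_{a,b}},\qquad f_{a,b}\in\mathbb{C}[x^ay^b][[t]],$$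 over all primitive $(a,b)\in\mathbb{Z}^2$ lying strictly in the first quadrant ($a,b>0$; primitive: $\gcd(a,b)=1$). The factors are ordered by slope: in the written composition, slopes $b/a$ decrease from left to right, so that the factors are applied in order of increasing slope (for example $T_2^{-1}\circ S_1\circ T_2\circ S_1^{-1}=\theta_{(1,2),1+t^3xy^2}\circ\theta_{(1,1),(1+t^2xy)^2}$). Each $f_{a,b}$ is a series in $(tx)^a(ty)^b$, and $\mathsf{f}_{a,b}(z)\in\mathbb{Q}[[z]]$ denotes the one-variable series with $f_{a,b}(t,x,y)=\mathsf{f}_{a,b}\big((tx)^a(ty)^b\big)$. *)

(* Defs.v *)
From HB Require Import structures.
From mathcomp Require Import all_boot all_order all_algebra.
From mathcomp Require Import boolp.
From mathcomp Require Import finmap xfinmap monalg.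

Set Implicit Arguments.
Unset Strict Implicit.
Unset Printing Implicit Defensive.

Import GRing.Theory Num.Theory.
Local Open Scope ring_scope.

(* The library's product on {malg K[M]} needs a monoid M without non-trivial
   units, which excludes Z^2; only its module structure is reused. *)
Definition laurent (K : comNzRingType) := {malg K[(int * int)%type]}.

Section LaurentRing.
Context {K : comNzRingType}.
Implicit Types (c : K) (m : int * int) (g : laurent K).

HB.instance Definition _ := GRing.Lmodule.on (laurent K).

(* c x^(m.1) y^(m.2) *)
Definition lterm c m : laurent K := << c *g m >>%R.

Definition lmul (g1 g2 : laurent K) : laurent K :=
  \sum_(m1 <- msupp g1) \sum_(m2 <- msupp g2)
     lterm (g1@_m1 * g2@_m2) (m1 + m2).

Let ltermD c1 c2 m : lterm (c1 + c2) m = lterm c1 m + lterm c2 m.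
Proof. exact: monalgUD. Qed.

Let lterm0 m : lterm 0 m = 0.
Proof. exact: monalgU0. Qed.

Let lmulw (d1 d2 : {fset int * int}) g1 g2 :
    (msupp g1 `<=` d1)%fset -> (msupp g2 `<=` d2)%fset ->
  lmul g1 g2 = \sum_(m1 <- d1) \sum_(m2 <- d2)
                  lterm (g1@_m1 * g2@_m2) (m1 + m2).
Proof.
move=> le1 le2; rewrite /lmul (big_fset_incl _ le1) /=; last first.
  by move=> m _ /mcoeff_outdom ->; rewrite big1 // => j _; rewrite mul0r lterm0.
apply/eq_bigr=> m _; apply: big_fset_incl => // j _ /mcoeff_outdom ->.
by rewrite mulr0 lterm0.
Qed.

Let lmulC : commutative lmul.
Proof.
move=> g1 g2; rewrite /lmul exchange_big; apply/eq_bigr => m1 _.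
by apply/eq_bigr => m2 _; rewrite mulrC addrC.
Qed.

Let lmulDl : left_distributive lmul +%R.
Proof.
move=> g1 g2 g; set d := (msupp g1 `|` msupp g2)%fset.
rewrite (@lmulw d (msupp g) (g1 + g2)) ?msuppD_le //.
rewrite (@lmulw d (msupp g) g1) ?fsubsetUl //.
rewrite (@lmulw d (msupp g) g2) ?fsubsetUr //.
rewrite -big_split; apply/eq_bigr => m1 _; rewrite -big_split.
by apply/eq_bigr => m2 _; rewrite /= mcoeffD mulrDl ltermD.
Qed.

Let lmulDr : right_distributive lmul +%R.
Proof. by move=> g g1 g2; rewrite lmulC lmulDl !(lmulC g). Qed.

Let lmul0 : left_zero 0 lmul.
Proof. by move=> g; rewrite /lmul msupp0 big_seq_fset0. Qed.

Lemma lmul_term c1 c2 m1 m2 :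
  lmul (lterm c1 m1) (lterm c2 m2) = lterm (c1 * c2) (m1 + m2).
Proof.
by rewrite (lmulw (@msuppU_le _ _ m1 c1) (@msuppU_le _ _ m2 c2))
  !big_seq_fset1 !mcoeffUU.
Qed.

Let lsum g : g = \sum_(m <- msupp g) lterm g@_m m.
Proof. exact: monalgE. Qed.

Let lmul_suml I (r : seq I) (F : I -> laurent K) g :
  lmul (\sum_(i <- r) F i) g = \sum_(i <- r) lmul (F i) g.
Proof. exact: (big_morph (lmul^~ g) (fun _ _ => lmulDl _ _ _) (lmul0 _)). Qed.

Let lmul_sumr I (r : seq I) (F : I -> laurent K) g :
  lmul g (\sum_(i <- r) F i) = \sum_(i <- r) lmul g (F i).
Proof. by rewrite lmulC lmul_suml; apply/eq_bigr => i _; rewrite lmulC. Qed.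

Let lmulA : associative lmul.
Proof.
move=> g1 g2 g3; rewrite (lsum g1) (lsum g2) (lsum g3) !lmul_suml.
apply/eq_bigr => m1 _.
rewrite lmul_sumr [lmul _ (\sum_(i <- msupp g2) _) in RHS]lmul_sumr lmul_suml.
apply/eq_bigr => m2 _; rewrite !lmul_sumr; apply/eq_bigr => m3 _.
by rewrite !lmul_term mulrA addrA.
Qed.

Let lmul1 : left_id (lterm 1 0) lmul.
Proof.
move=> g; rewrite {1}(lsum g) lmul_sumr [RHS]lsum; apply/eq_bigr => m _.
by rewrite lmul_term mul1r add0r.
Qed.

Let lone_neq0 : lterm 1 0 != 0 :> laurent K.
Proof. by apply/eqP/malgP=> /(_ 0); rewrite mcoeff0 mcoeffUU; apply/eqP/oner_neq0. Qed.

HB.instance Definition _ := GRing.Zmodule_isComNzRing.Build (laurent K)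
  lmulA lmulC lmul1 lmulDl lone_neq0.

End LaurentRing.

Record fps (L : Type) := FPS { coefs :> nat -> L }.

Section FpsRing.
Context {L : comNzRingType}.
Implicit Types (F G : fps L).

HB.instance Definition _ := gen_eqMixin (fps L).
HB.instance Definition _ := gen_choiceMixin (fps L).

Lemma fpsP F G : (forall n, F n = G n) -> F = G.
Proof. by case: F G => [F] [G] /= /funext ->. Qed.

Definition fadd F G := FPS (fun n => F n + G n).
Definition fopp F := FPS (fun n => - F n).
Definition fmul F G := FPS (fun n => \sum_(i < n.+1) F i * G (n - i)%N).
Definition fpsC (c : L) := FPS (fun n => if n == 0%N then c else 0).

Let faddA : associative fadd.
Proof. by move=> F G H; apply/fpsP => n /=; rewrite addrA. Qed.
Let faddC : commutative fadd.
Proof. by move=> F G; apply/fpsP => n /=; rewrite addrC. Qed.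
Let fadd0 : left_id (fpsC 0) fadd.
Proof. by move=> F; apply/fpsP => n /=; case: ifP => _; rewrite add0r. Qed.
Let faddN : left_inverse (fpsC 0) fopp fadd.
Proof. by move=> F; apply/fpsP => n /=; case: ifP => _; rewrite addNr. Qed.

HB.instance Definition _ :=
  GRing.isZmodule.Build (fps L) faddA faddC fadd0 faddN.

(* As for {poly L}, the ring laws are read off truncated coefficients. *)
Let trunc n F : {poly L} := \poly_(i < n.+1) F i.

Let coef_trunc n F i : (i <= n)%N -> (trunc n F)`_i = F i.
Proof. by move=> le_in; rewrite coef_poly ltnS le_in. Qed.

Let fmulE n F G k : (k <= n)%N -> fmul F G k = (trunc n F * trunc n G)`_k.
Proof.
move=> le_kn; rewrite coefM; apply/eq_bigr => i _.
rewrite !coef_trunc //; first exact: leq_trans (leq_subr _ _) le_kn.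
by apply: leq_trans le_kn; rewrite -ltnS.
Qed.

Let coefM_congr n (p p' q q' : {poly L}) :
    (forall i, (i <= n)%N -> p`_i = p'`_i) ->
    (forall i, (i <= n)%N -> q`_i = q'`_i) ->
  (p * q)`_n = (p' * q')`_n.
Proof.
move=> hp hq; rewrite !coefM; apply/eq_bigr => i _.
by rewrite hp ?hq ?leq_subr // -ltnS.
Qed.

Let fmulC : commutative fmul.
Proof. by move=> F G; apply/fpsP => n; rewrite !(@fmulE n) // mulrC. Qed.

Let fmulA : associative fmul.
Proof.
move=> F G H; apply/fpsP => n; rewrite !(@fmulE n) //.
transitivity (trunc n F * (trunc n G * trunc n H))`_n.
  by apply: coefM_congr => // i le_in; rewrite coef_trunc // (@fmulE n).
rewrite mulrA; apply: coefM_congr => // i le_in.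
by rewrite coef_trunc // (@fmulE n).
Qed.

Let fmul1 : left_id (fpsC 1) fmul.
Proof.
move=> F; apply/fpsP => n /=; rewrite big_ord_recl mul1r subn0 big1 ?addr0 //.
by move=> i _; rewrite mul0r.
Qed.

Let fmulDl : left_distributive fmul fadd.
Proof.
move=> F G H; apply/fpsP => n /=; rewrite -big_split; apply/eq_bigr => i _.
by rewrite mulrDl.
Qed.

Let fone_neq0 : fpsC 1 != fpsC 0.
Proof. by apply/eqP => /(congr1 (fun F => coefs F 0)) /= /eqP; rewrite oner_eq0. Qed.

HB.instance Definition _ := GRing.Zmodule_isComNzRing.Build (fps L)
  fmulA fmulC fmul1 fmulDl fone_neq0.

Definition funit : pred (fps L) := fun F => `[< exists G, G * F = 1 >].

Definition finv F : fps L :=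
  if pselect (exists G, G * F = 1) is left e then sval (cid e) else F.

Let fmulV : {in funit, left_inverse 1 finv *%R}.
Proof.
move=> F /asboolP uF; rewrite /finv; case: pselect => // e.
by case: (cid e).
Qed.

Let funitP F G : G * F = 1 -> funit F.
Proof. by move=> GF; apply/asboolP; exists G. Qed.

Let finv_out : {in [predC funit], finv =1 id}.
Proof.
by move=> F /asboolP nF; rewrite /finv; case: pselect.
Qed.

HB.instance Definition _ := GRing.ComNzRing_hasMulInverse.Build (fps L)
  fmulV funitP finv_out.

Definition fpsT : fps L := FPS (fun n => (n == 1%N)%:R).

End FpsRing.

Definition fps_map (L M : Type) (h : L -> M) (F : fps L) : fps M :=
  FPS (fun n => h (F n)).

Definition eqmodt (L : Type) (k : nat) (F G : fps L) :=
  forall n, (n < k)%N -> F n = G n.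

Section TropicalVertex.
Context {K : fieldType}.

Definition tring := fps (laurent K).
HB.instance Definition _ := GRing.ComUnitRing.on tring.

Definition tt : tring := fpsT.
Definition xy (a b : int) : tring := fpsC (lterm 1 (a, b)).
Definition xx : tring := xy 1 0.
Definition yy : tring := xy 0 1.

(* The structure map K[[t]] -> K[x, 1/x, y, 1/y][[t]]. *)
Definition tscalar : fps K -> tring := fps_map (fun c => lterm c 0).

Record taut := TAut {
  taut_fun :> {rmorphism tring -> tring};
  taut_inv : tring -> tring;
  tautK : cancel taut_fun taut_inv;
  taut_invK : cancel taut_inv taut_fun;
  taut_scalar : forall c, taut_fun (tscalar c) = tscalar c
}.

(* f = 1 + t x^a y^b g(x^a y^b, t) with g in K[z][[t]]. *)
Definition tv_function (a b : int) (f : tring) :=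
  exists g : fps {poly K},
    f = 1 + tt * xy a b
          * fps_map (fun p => (map_poly (lterm^~ 0) p).[lterm 1 (a, b)]) g.

(* phi = theta_{(a,b),f}; such a phi is unique, since x, y and K[[t]] generate
   a t-adically dense subring together with 1/x and 1/y. *)
Definition is_theta (a b : int) (f : tring) (phi : taut) :=
  [/\ tv_function a b f, phi xx = xx * f ^ (- b) & phi yy = yy * f ^ a].

Definition in_quadrant (v : int * int) := (0 < v.1) && (0 < v.2).
Definition quad_primitive (v : int * int) :=
  in_quadrant v && coprimez v.1 v.2.

Definition slope_gt (v w : int * int) := v.2 * w.1 > w.2 * v.1.

Definition comp_seq (theta : int * int -> taut) (s : seq (int * int)) :
    tring -> tring :=
  foldr (fun v phi => theta v \o phi) id s.

(* phi is the product of the theta v over all primitive v in the open first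
   quadrant, slopes decreasing from left to right: for each k only finitely
   many theta v are nontrivial mod t^k, and phi agrees mod t^k with the ordered
   composition of finitely many factors including those. *)
Definition is_slope_product (theta : int * int -> taut)
    (phi : tring -> tring) :=
  forall k : nat, exists s : seq (int * int),
    [/\ all quad_primitive s, sorted slope_gt s,
        forall v, quad_primitive v -> v \notin s ->
          forall F, eqmodt k (theta v F) F
      & forall F, eqmodt k (phi F) (comp_seq theta s F)].

(* T^-1 o S o T o S^-1 = prod theta_{v, f v}. *)
Definition commutator_factorization (l1 l2 : nat) (f : int * int -> tring) :=
  exists (S T : taut) (theta : int * int -> taut),
    [/\ is_theta 1 0 ((1 + tt * xx) ^+ l1) S,
        is_theta 0 1 ((1 + tt * yy) ^+ l2) T,
        forall v, quad_primitive v -> is_theta v.1 v.2 (f v) (theta v)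
      & is_slope_product theta (taut_inv T \o S \o T \o taut_inv S)].

(* fs(u); the sum defining each coefficient is the full one when u is
   divisible by t. *)
Definition series_eval (fs : fps rat) (u : tring) : tring :=
  FPS (fun N => \sum_(n < N.+1) (ratr (fs n) : K) *: (u ^+ n : tring) N).

Definition is_reduced_series (v : int * int) (f : tring) (fs : fps rat) :=
  f = series_eval fs ((tt * xx) ^ v.1 * (tt * yy) ^ v.2).

End TropicalVertex.

Arguments tring : clear implicits.
Arguments taut : clear implicits.

(* Main.v *)
Require Import Defs.
From mathcomp Require Import all_boot all_order all_algebra.
From mathcomp Require Import boolp classical_sets fsbigop.
From mathcomp Require Import finmap monalg.
From mathcomp Require Import reals complex.
From mathcomp Require Import ring zify.

Set Implicit Arguments.
Unset Strict Implicit.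
Unset Printing Implicit Defensive.

Import Order.TTheory GRing.Theory Num.Theory.
Local Open Scope ring_scope.

(** Put X = tx and Y = ty. All the automorphisms at hand multiply a monomial by a
    power series in X and Y, so the power of t can be forgotten and each of them
    becomes an array of coefficients indexed by pairs of monomials.

    Put U = S o T o S^-1. The factorization says that U is T followed on the right
    by the ordered product of the theta_v, that is, an ordered product over the
    slopes from infinity downwards, with T for the slope infinity. Now U is the
    analogue of T for the function h = Y (1 + X)^l1 in place of Y, and h is fixed
    by the involution iota: X |-> 1/X, Y |-> Y X^l1 of the torus. Since iota has
    determinant -1, conjugation by it inverts U, and it carries theta_v with
    function f_v to the inverse of theta_{iota v} with the same function, where
    iota (a, b) = (l1 b - a, b). Conjugating the factorization by iota and
    inverting therefore gives a second factorization of U, again with decreasing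
    slopes, in which the function of v is f_{iota v}. Ordered factorizations are
    unique, so f_v = f_{iota v}. The statement for (a, l2 a - b) follows by
    exchanging x and y, which turns the commutator relation for (l1, l2) into the
    inverse of the one for (l2, l1).

    Two points need care. First, iota does not preserve the first quadrant, so one
    must know that only exponents in the iota-stable cone 0 <= a <= l1 b occur.
    This holds for U X = X (1 + h)^(-l2), and it passes to the functions f_v.
    Both this and uniqueness are inductions on the degree in Y resting on
    [ray_prod_diff]: the first difference between two families of functions enters
    the product linearly, and can be read off the image of X. Secondly, the
    identity iota U iota = U^-1 is not computed from a formula for U: it follows
    from U o S = S o T and the symmetry of the binomial coefficients of
    (1 + X)^(l1 j), on the monomials X^i Y^j with j >= 0. *)

(** * Operators given by their coefficients on monomials *)

(** The closed first quadrant. *)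
Definition quad (m : int * int) := (0 <= m.1) && (0 <= m.2).

Lemma quadB (u v : int * int) : quad (u - v) = (v.1 <= u.1) && (v.2 <= u.2).
Proof. by case: u v => a b [c d]; rewrite /quad /= !subr_ge0. Qed.

Lemma quadD m n : quad m -> quad n -> quad (m + n).
Proof.
case: m n => [a b] [c d] /andP[/= ? ?] /andP[/= ? ?].
by apply/andP; split; apply: addr_ge0.
Qed.

Lemma sub_split (V : zmodType) (u v w : V) : w - v = (u - v) + (w - u).
Proof. by rewrite [RHS]addrC addrA subrK. Qed.

(** The lattice points u with v <= u <= w coordinatewise. *)
Definition box (v w : int * int) : {fset int * int} :=
  seq_fset Datatypes.tt
    [seq (v.1 + i%:Z, v.2 + j%:Z) | i <- iota 0 `|(w.1 - v.1)%R|.+1,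
                                    j <- iota 0 `|(w.2 - v.2)%R|.+1].

Lemma mem_box v w u : quad (u - v) -> quad (w - u) -> u \in box v w.
Proof.
case: v w u => [v1 v2] [w1 w2] [u1 u2] /andP[/= h1 h2] /andP[/= h3 h4].
rewrite seq_fsetE; apply/allpairsP.
exists (`|(u1 - v1)%R|%N, `|(u2 - v2)%R|%N); rewrite !mem_iota /=.
by split; [lia | lia | congr (_, _); lia].
Qed.

Section Operators.
Variable K : fieldType.
Implicit Types (A B C : int * int -> int * int -> K) (u v w : int * int).

(** An operator is an array A, where A v u stands for the coefficient of z^u in
    the image of the monomial z^v. It is supported in P if A v u <> 0 only when
    u - v lies in P. *)
Definition op_supp (P : pred (int * int)) A :=
  forall v u, A v u != 0 -> P (u - v).

Definition op_id v u : K := (v == u)%:R.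

(** The composite A o B, with B applied first. The sum has finitely many nonzero
    terms for operators supported in the quadrant; a sum with infinitely many
    nonzero terms is 0 by convention. *)
Definition op_comp A B v w : K := \sum_(u \in [set: int * int]%classic) B v u * A u w.

Lemma op_compEsum A B v w :
  op_comp A B v w = \sum_(u \in [set: int * int]%classic) B v u * A u w.
Proof. by []. Qed.

Lemma op_supp_eq0 P A v u : op_supp P A -> ~~ P (u - v) -> A v u = 0.
Proof. by move=> sA; apply: contraNeq => /sA. Qed.

Lemma op_compE A B v w (X : {fset int * int}) :
    (forall u, B v u != 0 -> A u w != 0 -> u \in X) ->
  op_comp A B v w = \sum_(u <- X) B v u * A u w.
Proof.
move=> hX; apply: fsbigTE => u uX; apply/eqP; apply: contraNT uX.
by rewrite mulf_eq0 negb_or => /andP[]; apply: hX.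
Qed.

Lemma op_comp_box A B v w : op_supp quad A -> op_supp quad B ->
  op_comp A B v w = \sum_(u <- box v w) B v u * A u w.
Proof. by move=> sA sB; apply: op_compE => u /sB ? /sA ?; apply: mem_box. Qed.

Lemma op_comp_supp (P : pred (int * int)) A B :
    (forall m n, P m -> P n -> P (m + n)) ->
  op_supp P A -> op_supp P B -> op_supp P (op_comp A B).
Proof.
move=> PD sA sB v w; apply: contraNT => nP.
apply/eqP/fsbig1 => u _; apply/eqP; apply: contraNT nP.
rewrite mulf_eq0 negb_or => /andP[/sB h /sA h'].
by rewrite (sub_split u) PD.
Qed.

Lemma op_comp_quad A B :
  op_supp quad A -> op_supp quad B -> op_supp quad (op_comp A B).
Proof. by apply: op_comp_supp => m n; apply: quadD. Qed.

Lemma op_id_supp (P : pred (int * int)) : P 0 -> op_supp P op_id.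
Proof. by move=> P0 v u; rewrite /op_id; case: (eqVneq v u) => [->|_]; rewrite ?subrr ?eqxx. Qed.

Lemma op_id_quad : op_supp quad op_id.
Proof. exact: op_id_supp. Qed.

Lemma op_comp_sum1 (f : int * int -> K) w :
  \sum_(u \in [set: int * int]%classic) f u * (u == w)%:R = f w.
Proof.
rewrite (fsbigTE [fset w]%fset) ?big_seq_fset1 ?eqxx ?mulr1 // => u.
by rewrite inE => /negPf ->; rewrite mulr0.
Qed.

Lemma op_comp_idl A : op_comp op_id A = A.
Proof. by apply/funext => v; apply/funext => w; apply: op_comp_sum1. Qed.

Lemma op_comp_idr A : op_comp A op_id = A.
Proof.
apply/funext => v; apply/funext => w; rewrite /op_comp /op_id.
rewrite -[RHS](op_comp_sum1 (A^~ w)); apply: eq_fsbigr => u _.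
by rewrite mulrC eq_sym.
Qed.

(** Associativity needs the finiteness of all the intervals [v, w], hence the
    support conditions. *)
Lemma op_compA A B C : op_supp quad A -> op_supp quad B -> op_supp quad C ->
  op_comp A (op_comp B C) = op_comp (op_comp A B) C.
Proof.
move=> sA sB sC; apply/funext => v; apply/funext => w.
have box2 (F G : int * int -> int * int -> K) v' w' :
    op_supp quad F -> op_supp quad G -> quad (v' - v) -> quad (w - w') ->
    op_comp F G v' w' = \sum_(u <- box v w) G v' u * F u w'.
  move=> sF sG hv hw; apply: op_compE => u /sG hu /sF hu'; apply: mem_box.
    by rewrite (sub_split v') quadD.
  by rewrite (sub_split w') quadD.
have sBC := op_comp_quad sB sC; have sAB := op_comp_quad sA sB.
rewrite !op_comp_box //.
transitivity (\sum_(u <- box v w) \sum_(x <- box v w) C v x * B x u * A u w).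
  apply: eq_bigr => u _; rewrite -mulr_suml.
  have [->|Au] := eqVneq (A u w) 0; first by rewrite !mulr0.
  by rewrite box2 ?subrr ?(sA _ _ Au).
rewrite exchange_big; apply: eq_bigr => x _ /=.
have [->|Cx] := eqVneq (C v x) 0.
  by rewrite mul0r big1 // => u _; rewrite !mul0r.
rewrite box2 ?subrr ?(sC _ _ Cx) // mulr_sumr.
by apply: eq_bigr => u _; rewrite mulrA.
Qed.

(** The linear degree (a, b) |-> e a + b: the total degree for e = 1, the degree in
    y for e = 0. *)
Definition opdeg (e : nat) (m : int * int) : int := e%:Z * m.1 + m.2.

Lemma opdeg_ge0 e m : quad m -> 0 <= opdeg e m.
Proof. by case: m => a b /andP[/= ? ?]; rewrite /opdeg /=; nia. Qed.

Lemma opdegD e m n : opdeg e (m + n) = opdeg e m + opdeg e n.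
Proof. by rewrite /opdeg /=; ring. Qed.

Lemma opdegB e v u w : opdeg e (w - v) = opdeg e (u - v) + opdeg e (w - u).
Proof. by rewrite -opdegD -sub_split. Qed.

(** Equality of the entries that raise the degree by less than k. *)
Definition eqdeg e (k : int) A B :=
  forall v u, opdeg e (u - v) < k -> A v u = B v u.

Lemma eqdeg_sym e k A B : eqdeg e k A B -> eqdeg e k B A.
Proof. by move=> h v u /h. Qed.

Lemma eqdeg_comp e k A A' B B' :
    op_supp quad A -> op_supp quad A' -> op_supp quad B -> op_supp quad B' ->
  eqdeg e k A A' -> eqdeg e k B B' -> eqdeg e k (op_comp A B) (op_comp A' B').
Proof.
move=> sA sA' sB sB' eA eB v w vw; rewrite !op_comp_box //.
apply: eq_bigr => u _; rewrite (opdegB e v u w) in vw.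
have [q1|nq1] := boolP (quad (u - v)); last first.
  by rewrite (op_supp_eq0 sB) // (op_supp_eq0 sB') // !mul0r.
have [q2|nq2] := boolP (quad (w - u)); last first.
  by rewrite (op_supp_eq0 sA) // (op_supp_eq0 sA') // !mulr0.
have := opdeg_ge0 e q1; have := opdeg_ge0 e q2 => d1 d2.
by rewrite eA 1?eB //; lia.
Qed.

End Operators.
Arguments op_id {K} v u.
(** * Integer powers of power series *)

Section Fps.
Variable L : comNzRingType.
Implicit Types F G H : fps L.

Lemma fpsM F G n : (F * G) n = \sum_(i < n.+1) F i * G (n - i)%N.
Proof. by []. Qed.

Lemma fpsD F G n : (F + G) n = F n + G n.
Proof. by []. Qed.

Lemma fps1 n : (1 : fps L) n = (n == 0%N)%:R.
Proof. by rewrite /=; case: (n == 0)%N. Qed.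

Lemma fps0 n : (0 : fps L) n = 0.
Proof. by rewrite /=; case: (n == 0)%N. Qed.

Lemma fps_sum I (r : seq I) (P : pred I) (F : I -> fps L) n :
  (\sum_(i <- r | P i) F i) n = \sum_(i <- r | P i) F i n.
Proof. by apply: (big_morph (fun F : fps L => F n)) => [? ?|]; rewrite ?fps0. Qed.

Lemma fps_exp_lt H n k : H 0%N = 0 -> (n < k)%N -> (H ^+ k) n = 0.
Proof.
move=> H0; elim: k n => // k IH n; rewrite ltnS => nk.
rewrite exprS fpsM big_ord_recl H0 mul0r add0r big1 // => i _.
rewrite IH ?mulr0 //= /bump /=; have := ltn_ord i; lia.
Qed.

Lemma fps_unit F : F 0%N = 1 -> F \is a GRing.unit.
Proof.
move=> F0; pose H := 1 - F.
have H0 : H 0%N = 0 by rewrite /H /= F0 subrr.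
pose G : fps L := FPS (fun n => \sum_(k < n.+1) (H ^+ k) n).
have GE n m : (n <= m)%N -> G n = (\sum_(k < m.+1) H ^+ k) n.
  move=> nm; rewrite fps_sum /G /= (big_ord_widen m.+1 (fun k => (H ^+ k) n)) //.
  rewrite big_mkcond; apply: eq_bigr => i _; case: ltnP => // ni.
  by rewrite fps_exp_lt.
apply/unitrPr; exists G; apply: fpsP => n; rewrite fpsM.
have -> : F = 1 - H by rewrite /H opprB addrC subrK.
transitivity (((1 - H) * \sum_(k < n.+1) H ^+ k) n).
  by rewrite fpsM; apply: eq_bigr => i _; rewrite (GE _ n) // leq_subr.
have -> : (1 - H) * \sum_(k < n.+1) H ^+ k = 1 - H ^+ n.+1.
  by rewrite -[in RHS](expr1n _ n.+1) subrXX; congr (_ * _);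
     apply: eq_bigr => i _; rewrite expr1n mul1r.
by rewrite fpsD [X in _ + X](_ : _ = - (H ^+ n.+1) n) // fps_exp_lt // subr0.
Qed.

Lemma fps_expz0 F k : F 0%N = 1 -> (F ^ k) 0%N = 1.
Proof.
move=> F0; have E (n : nat) : (F ^+ n) 0%N = 1.
  elim: n => [|n IH]; first by rewrite expr0 fps1.
  by rewrite exprS fpsM big_ord1 F0 mul1r.
case: (intP k) => [|n|n]; first by rewrite expr0z fps1.
  exact: E.
have u : F ^+ n.+1 \is a GRing.unit by rewrite unitrX // fps_unit.
rewrite -exprnN; have := congr1 (fun G : fps L => G 0%N) (divrr u).
by rewrite fpsM big_ord1 E mul1r fps1.
Qed.

(** The first coefficient at which two products differ is additive in the
    factors. *)
Lemma fps_mul_diff F F' G G' n :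
    F 0%N = 1 -> F' 0%N = 1 -> G 0%N = 1 -> G' 0%N = 1 -> (0 < n)%N ->
    (forall i, (i < n)%N -> F i = F' i) -> (forall i, (i < n)%N -> G i = G' i) ->
  (F * G) n - (F' * G') n = (F n - F' n) + (G n - G' n).
Proof.
case: n => // n F0 F0' G0 G0' _ eF eG.
have E H H' : (H * H') n.+1 =
    H 0%N * H' n.+1 + (\sum_(i < n) H i.+1 * H' (n - i)%N + H n.+1 * H' 0%N).
  rewrite fpsM big_ord_recl big_ord_recr /= subn0 /bump /= add1n subnn.
  by congr (_ + (_ + _)); apply: eq_bigr => i _; rewrite /bump /= add1n subSS.
rewrite !E F0 F0' G0 G0' !mul1r !mulr1.
rewrite (eq_bigr (fun i : 'I_n => F' i.+1 * G' (n - i)%N)); last first.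
  by move=> i _; have := ltn_ord i => lt_in; rewrite eF ?eG //; lia.
by ring.
Qed.

(** If F and G first differ at the coefficient n, the coefficients n of F^k and of
    G^k differ by k times as much. *)
Lemma fps_expz_diff F G (k : int) n : F 0%N = 1 -> G 0%N = 1 -> (0 < n)%N ->
    (forall i, (i < n)%N -> F i = G i) ->
  (F ^ k) n - (G ^ k) n = (F n - G n) *~ k.
Proof.
move=> F0 G0 n0; have [m le_nm] := ubnP n.
elim: m n n0 le_nm k => // m IHm n n0 le_nm k eFG.
have eq_lt j i : (i < n)%N -> (F ^ j) i = (G ^ j) i.
  case: i => [|i] lt_in; first by rewrite (fps_expz0 j F0) (fps_expz0 j G0).
  apply/eqP; rewrite -subr_eq0 IHm //; try lia; last first.
    by move=> i' lt_i'; apply: eFG; lia.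
  by rewrite eFG // subrr mul0rz.
have E (j : nat) : (F ^ j) n - (G ^ j) n = (F n - G n) *~ j.
  elim: j => [|j IHj]; first by rewrite !expr0z subrr mulr0z.
  rewrite !exprSz fps_mul_diff ?fps_expz0 //; last by move=> i; apply: eq_lt.
  by rewrite IHj; exact: (esym (mulrS _ _)).
case: k => j; first exact: E.
rewrite NegzE mulrNz -E.
have e H : H 0%N = 1 -> H ^ j.+1%:Z * H ^ (- j.+1%:Z) = 1.
  by move=> H0; rewrite -exprzDr ?fps_unit // subrr expr0z.
have := fps_mul_diff (fps_expz0 j.+1 F0) (fps_expz0 j.+1 G0)
  (fps_expz0 (- j.+1%:Z) F0) (fps_expz0 (- j.+1%:Z) G0) n0 (eq_lt _) (eq_lt _).
by rewrite (e F F0) (e G G0) subrr addrC => /esym/eqP; rewrite addr_eq0 => /eqP.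
Qed.

End Fps.
(** * Operators attached to a ray *)

Definition det (w v : int * int) : int := w.1 * v.2 - w.2 * v.1.

Lemma natmul_pair (w : int * int) n : w *+ n = (w.1 *+ n, w.2 *+ n).
Proof. by rewrite -(pairMnE w n); case: (w *+ n). Qed.

Lemma detDn w v n : det w (v + w *+ n) = det w v.
Proof. by case: w v => a b [c d]; rewrite natmul_pair /det /=; ring. Qed.

Lemma coprimez_neq0 (w : int * int) : coprimez w.1 w.2 -> w != 0.
Proof. by case: w => a b /=; apply: contraL => /eqP[-> ->]. Qed.

Lemma mulrIn_pair (w : int * int) : w != 0 -> injective (GRing.natmul w).
Proof.
case: w => a b; rewrite -pair_eqE /= negb_and => h m n; rewrite !natmul_pair.
by case=> /= e1 e2; case/orP: h => h; [have := mulrIn h e1 | have := mulrIn h e2].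
Qed.

Section Ray.
Variable K : fieldType.
Implicit Types (F G : fps K) (u v w : int * int).

(** The operator z^v |-> z^v F(z^w)^det(w, v), that is theta_{w,F(z^w)} with t set
    to 1. For primitive w the integer n with u - v = n w, if there is one, is the
    gcd of the coordinates of u - v. *)
Definition ray_op w F v u : K :=
  let n := gcdn `|(u.1 - v.1)%R| `|(u.2 - v.2)%R| in
  if u - v == w *+ n then (F ^ det w v) n else 0.

Lemma ray_opE w F v n : coprimez w.1 w.2 ->
  ray_op w F v (v + w *+ n) = (F ^ det w v) n.
Proof.
case: w v => a b [c d] /eqP/= cop; rewrite /ray_op natmul_pair /=.
rewrite ![_ + _ *+ _]addrC !addrK.
have absn (x : int) : `|x *+ n|%N = (`|x| * n)%N by rewrite -mulr_natr abszM natz.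
rewrite !absn -muln_gcdl.
have -> : gcdn `|a| `|b| = 1%N by move: cop; rewrite /gcdz; case.
by rewrite mul1n addrC addKr natmul_pair eqxx.
Qed.

Variant ray_spec w v u : Prop :=
  | OnRay n of u = v + w *+ n
  | OffRay of (forall n, u <> v + w *+ n).

Lemma rayP w v u : ray_spec w v u.
Proof.
have [[n e]|h] := pselect (exists n, u = v + w *+ n); first exact: (OnRay e).
by apply: OffRay => n e; apply: h; exists n.
Qed.

Lemma ray_op0 w F v u : (forall n, u <> v + w *+ n) -> ray_op w F v u = 0.
Proof.
move=> h; rewrite /ray_op; case: eqP => // e.
by have := congr1 (+%R v) e; rewrite addrC subrK => /h.
Qed.

Lemma ray_op_supp (P : pred (int * int)) w F :
  (forall n, P (w *+ n)) -> op_supp P (ray_op w F).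
Proof.
move=> Pw v u; case: (rayP w v u) => [n ->|h]; last by rewrite ray_op0 ?eqxx.
by rewrite [v + _]addrC addrK.
Qed.

Lemma ray_op_quad w F : quad w -> op_supp quad (ray_op w F).
Proof.
case: w => a b /andP[/= a0 b0]; apply: ray_op_supp => n.
by rewrite natmul_pair /quad /= !mulrn_wge0.
Qed.

Lemma ray_op1 w : coprimez w.1 w.2 -> ray_op w 1 = op_id.
Proof.
move=> cop; apply/funext => v; apply/funext => u; rewrite /op_id.
case: (rayP w v u) => [n ->|h]; last first.
  rewrite ray_op0 //; case: eqP => // e; case: (h 0%N).
  by rewrite mulr0n addr0.
rewrite ray_opE // exp1rz fps1 -[X in _ = (X == _)%:R]addr0 (inj_eq (addrI v)).
by rewrite eq_sym -(mulr0n w) (inj_eq (mulrIn_pair (coprimez_neq0 cop))).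
Qed.

Lemma ray_op_comp w F G : coprimez w.1 w.2 -> F 0%N = 1 -> G 0%N = 1 ->
  op_comp (ray_op w F) (ray_op w G) = ray_op w (F * G).
Proof.
move=> cop F0 G0; apply/funext => v; apply/funext => u.
have winj := mulrIn_pair (coprimez_neq0 cop).
have cmp n m x : v + w *+ n = v + w *+ m + w *+ x -> n = (m + x)%N.
  by rewrite -addrA -mulrnDr => /addrI/winj.
case: (rayP w v u) => [n ->|h]; last first.
  rewrite [RHS]ray_op0 //; apply: fsbig1 => x _.
  case: (rayP w v x) => [m xE|h']; last by rewrite ray_op0 ?mul0r.
  rewrite mulrC ray_op0 ?mul0r // => k uE; case: (h (m + k)%N).
  by rewrite mulrnDr addrA -xE.
rewrite ray_opE // exprMz_comm ?fps_unit //; last exact: mulrC.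
rewrite mulrC fpsM /op_comp.
rewrite (fsbigE [seq v + w *+ i | i <- iota 0 n.+1]) //; last first.
- move=> x _ xr; case: (rayP w v x) => [m xE|h']; last by rewrite ray_op0 ?mul0r.
  rewrite mulrC ray_op0 ?mul0r // => k; rewrite xE => /cmp e.
  move: xr; rewrite xE => /negP[]; apply/mapP; exists m => //.
  by rewrite mem_iota e; lia.
- by rewrite map_inj_uniq ?iota_uniq // => i j /addrI/winj.
rewrite (eq_bigl xpredT); last by move=> x; rewrite in_setT.
rewrite big_map -(big_mkord xpredT (fun i => (G ^ det w v) i * (F ^ det w v) (n - i)%N)).
rewrite /index_iota subn0; apply: eq_big_seq => i; rewrite mem_iota add0n => /andP[_ lt_in].
have -> : v + w *+ n = v + w *+ i + w *+ (n - i).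
  by rewrite -addrA -mulrnDr subnKC // -ltnS.
by rewrite !ray_opE // detDn.
Qed.

Lemma ray_op_inv w F : coprimez w.1 w.2 -> F 0%N = 1 ->
  op_comp (ray_op w F) (ray_op w F^-1) = op_id /\
  op_comp (ray_op w F^-1) (ray_op w F) = op_id.
Proof.
move=> cop F0; have F'0 : F^-1 0%N = 1 by rewrite -exprN1 fps_expz0.
split; [apply: etrans (ray_op_comp cop F0 F'0) _ |
        apply: etrans (ray_op_comp cop F'0 F0) _].
  by rewrite (mulrV (fps_unit F0)) (ray_op1 cop).
by rewrite (mulVr (fps_unit F0)) (ray_op1 cop).
Qed.

(** The linear involutions of determinant -1. *)
Definition reflection (h : int * int -> int * int) :=
  [/\ {morph h : u v / u + v}, involutive h &
      forall w v, det (h w) (h v) = - det w v].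

(** The conjugate h o A o h for an involution h of the exponents. *)
Definition op_conj (h : int * int -> int * int) (A : int * int -> int * int -> K) v u :=
  A (h v) (h u).

Lemma op_conj_comp h A B : involutive h ->
  op_conj h (op_comp A B) = op_comp (op_conj h A) (op_conj h B).
Proof.
move=> hK; apply/funext => v; apply/funext => u.
rewrite /op_conj /op_comp (reindex_fsbigT h) //.
exact: inv_bij.
Qed.

Lemma op_conj_id h : involutive h -> op_conj h op_id = op_id.
Proof.
move=> hK; apply/funext => v; apply/funext => u.
by rewrite /op_conj /op_id (inj_eq (inv_inj hK)).
Qed.

Lemma reflection0 h : reflection h -> h 0 = 0.
Proof. by case=> hD _ _; apply: (addrI (h 0)); rewrite -hD !addr0. Qed.

Lemma reflectionMn h w n : reflection h -> h (w *+ n) = h w *+ n.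
Proof.
move=> hR; elim: n => [|n IH]; first by rewrite !mulr0n reflection0.
by rewrite !mulrS -IH; case: hR.
Qed.

Lemma reflectionB h u v : reflection h -> h (u - v) = h u - h v.
Proof. by case=> hD _ _; apply: (addIr (h v)); rewrite -hD !subrK. Qed.

(** A reflection reverses the orientation: it carries theta_w to the inverse of
    theta_{h w}. *)
Lemma op_conj_ray h w F : reflection h -> coprimez w.1 w.2 ->
    coprimez (h w).1 (h w).2 -> F 0%N = 1 ->
  op_conj h (ray_op w F) = ray_op (h w) F^-1.
Proof.
move=> hR cop cop' F0; have [hD hK hdet] := hR.
apply/funext => v; apply/funext => u; rewrite /op_conj.
case: (rayP (h w) v u) => [n ->|off].
  rewrite hD (reflectionMn _ _ hR) hK !ray_opE //.
  by rewrite exprz_inv -{2}[v]hK hdet opprK.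
rewrite !ray_op0 // => n e; apply: (off n); apply: (inv_inj hK).
by rewrite e hD (reflectionMn _ _ hR) hK.
Qed.

End Ray.
(** * Ordered products of ray operators *)

(** The primitive directions (a, b) with a >= 0 and b > 0, so that (0, 1) is one of
    them and (1, 0) is not. *)
Definition ray_dir (w : int * int) := [&& 0 <= w.1, 0 < w.2 & coprimez w.1 w.2].

Lemma ray_dir_coprime w : ray_dir w -> coprimez w.1 w.2.
Proof. by case/and3P. Qed.

Lemma ray_dir_quad w : ray_dir w -> quad w.
Proof. by case/and3P => h1 h2 _; rewrite /quad h1 ltW. Qed.

Lemma ray_dir_eq x y n m : ray_dir x -> ray_dir y -> (0 < n)%N ->
  x *+ n = y *+ m -> x = y.
Proof.
have gcdE w k : ray_dir w -> gcdn `|(w *+ k).1| `|(w *+ k).2| = k.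
  case: w => a b /and3P[/= _ _ /eqP cop]; rewrite natmul_pair /=.
  have absn (z : int) : `|z *+ k|%N = (`|z| * k)%N by rewrite -mulr_natr abszM natz.
  by rewrite !absn -muln_gcdl; move: cop; rewrite /gcdz; case=> ->; rewrite mul1n.
move=> hx hy n0 e; have e' := gcdE _ n hx; rewrite e gcdE // in e'.
rewrite e' in e; case: x y e {hx hy} => a b [c d]; rewrite !natmul_pair /= => -[e1 e2].
have inj (p q : int) : p *+ n = q *+ n -> p = q.
  by rewrite -(mulr_natr p) -(mulr_natr q) natz => /mulIf; apply; lia.
by rewrite (inj _ _ e1) (inj _ _ e2).
Qed.

Section Products.
Variable K : fieldType.
Implicit Types (A B : int * int -> int * int -> K) (u v w : int * int).
Implicit Types (F G : fps K) (c d : int * int -> fps K) (s : seq (int * int)).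

Lemma opdeg0 m : opdeg 0 m = m.2.
Proof. by rewrite /opdeg mul0r add0r. Qed.

(** Operators supported in the quadrant that are the identity up to terms of higher
    degree in y. *)
Definition unipotent A :=
  op_supp quad A /\ forall v u, u.2 = v.2 -> A v u = (v == u)%:R.

Lemma unipotent_id : unipotent op_id.
Proof. by split=> //; apply: op_id_quad. Qed.

Lemma unipotent_ray w F : ray_dir w -> F 0%N = 1 -> unipotent (ray_op w F).
Proof.
move=> hw F0; split; first exact: (ray_op_quad (ray_dir_quad hw)).
move=> v u vu; case: (rayP w v u) => [n uE|off].
  rewrite uE ray_opE ?ray_dir_coprime //.
  have -> : n = 0%N.
    case/and3P: hw => _ + _; move: vu; rewrite uE; case: (v) (w) => ? ? [? ?].
    by rewrite natmul_pair /= => h1 h2; case: n uE h1 => // n _; rewrite mulrS; lia.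
  by rewrite fps_expz0 // mulr0n addr0 eqxx.
rewrite ray_op0 //; case: eqP => // e; case: (off 0%N).
by rewrite e mulr0n addr0.
Qed.

Lemma unipotent_comp A B : unipotent A -> unipotent B -> unipotent (op_comp A B).
Proof.
move=> [sA uA] [sB uB]; split; first exact: op_comp_quad.
move=> v w vw; rewrite -[RHS](op_comp_sum1 (fun u => (v == u)%:R)).
suff pt (u : int * int) : B v u * A u w = (v == u)%:R * (u == w)%:R.
  by apply: eq_fsbigr => u _; apply: pt.
have [e|ne] := eqVneq u.2 v.2; first by rewrite uB ?uA ?vw.
have -> : (v == u) = false by apply/negbTE; apply: contraNneq ne => ->.
rewrite mul0r; have [q1|nq1] := boolP (quad (u - v)); last first.
  by rewrite (op_supp_eq0 sB) ?mul0r.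
have [q2|nq2] := boolP (quad (w - u)); last first.
  by rewrite (op_supp_eq0 sA) ?mulr0.
by exfalso; move: q1 q2; rewrite !quadB; lia.
Qed.

(** To the first order in y at which they differ, composition is additive. *)
Lemma op_comp_diff J A A' B B' v w :
    unipotent A -> unipotent A' -> unipotent B -> unipotent B' ->
    eqdeg 0 J A A' -> eqdeg 0 J B B' -> 0 < J -> w.2 - v.2 = J ->
  op_comp A B v w - op_comp A' B' v w = (A v w - A' v w) + (B v w - B' v w).
Proof.
move=> [sA uA] [sA' uA'] [sB uB] [sB' uB'] eA eB J0 vwJ.
have vw : v != w by apply/eqP => vw; move: vwJ; rewrite vw subrr; lia.
have [q|nq] := boolP (quad (w - v)); last first.
  rewrite !(op_supp_eq0 (op_comp_quad _ _)) // (op_supp_eq0 sA) //.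
  by rewrite (op_supp_eq0 sA') // (op_supp_eq0 sB) // (op_supp_eq0 sB') // !subrr addr0.
rewrite !op_comp_box // -sumrB.
have hv : v \in box v w by rewrite mem_box ?subrr.
have hw : w \in box v w by rewrite mem_box ?subrr.
rewrite (big_fsetD1 v) //= (big_fsetD1 w) /=; last by rewrite !inE eq_sym vw.
rewrite (uB v v erefl) (uB' v v erefl) (uA w w erefl) (uA' w w erefl).
rewrite !eqxx !mul1r !mulr1.
suff pt (u : int * int) : u != w -> u != v ->
    B v u * A u w - B' v u * A' u w = 0.
  rewrite [X in _ + (_ + X) = _]big1_seq ?addr0 // => u.
  by rewrite !inE => /andP[_ /and3P[nuw nuv _]]; apply: pt.
move=> nuw nuv.
have [q1|nq1] := boolP (quad (u - v)); last first.
  by rewrite (op_supp_eq0 sB) // (op_supp_eq0 sB') // !mul0r subrr.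
have [q2|nq2] := boolP (quad (w - u)); last first.
  by rewrite (op_supp_eq0 sA) // (op_supp_eq0 sA') // !mulr0 subrr.
have [e|ne] := eqVneq u.2 v.2.
  by rewrite uB // uB' // eq_sym (negbTE nuv) !mul0r subrr.
have [e'|ne'] := eqVneq u.2 w.2.
  by rewrite uA // uA' // (negbTE nuw) !mulr0 subrr.
move: q1 q2; rewrite !quadB => /andP[_ q1] /andP[_ q2].
rewrite eA; last by rewrite opdeg0 /=; lia.
rewrite eB; last by rewrite opdeg0 /=; lia.
by rewrite subrr.
Qed.

Lemma fps_expz_eq F G k n : F 0%N = 1 -> G 0%N = 1 ->
  (forall i, (i <= n)%N -> F i = G i) -> (F ^ k) n = (G ^ k) n.
Proof.
case: n => [|n] F0 G0 e; first exact: etrans (fps_expz0 k F0) (esym (fps_expz0 k G0)).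
apply/eqP; rewrite -subr_eq0 (fps_expz_diff k F0 G0 (ltn0Sn n)); last first.
  by move=> i /ltnW; apply: e.
by rewrite e // subrr mul0rz.
Qed.

Lemma ray_op_eqdeg e k w F G : ray_dir w -> F 0%N = 1 -> G 0%N = 1 ->
    (forall i : nat, i%:Z * opdeg e w < k -> F i = G i) ->
  eqdeg e k (ray_op w F) (ray_op w G).
Proof.
move=> hw F0 G0 FG v u; case: (rayP w v u) => [n ->|off _]; last by rewrite !ray_op0.
have -> : v + w *+ n - v = w *+ n by rewrite addrC addKr.
have degn : opdeg e (w *+ n) = n%:Z * opdeg e w.
  by rewrite natmul_pair /opdeg /= -(mulr_natl w.1) -(mulr_natl w.2) natz; ring.
rewrite degn => lt_nk; have cop := ray_dir_coprime hw.
rewrite (ray_opE F v n cop) (ray_opE G v n cop).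
apply: (fps_expz_eq _ F0 G0) => i le_in; apply: FG.
have := opdeg_ge0 e (ray_dir_quad hw); nia.
Qed.

Lemma ray_op_eqdeg1 e k w F : ray_dir w -> F 0%N = 1 ->
    (forall i : nat, (0 < i)%N -> i%:Z * opdeg e w < k -> F i = 0) ->
  eqdeg e k (ray_op w F) op_id.
Proof.
move=> hw F0 hF; rewrite -(ray_op1 _ (ray_dir_coprime hw)).
apply: ray_op_eqdeg => // i lt_ik.
by rewrite fps1; case: i lt_ik => // i; apply: hF.
Qed.

(** The composite theta_{w_1} o ... o theta_{w_r} for s = [w_1; ...; w_r], the
    direction w carrying the series c w. *)
Definition ray_prod c s : int * int -> int * int -> K :=
  foldr (fun w A => op_comp (ray_op w (c w)) A) op_id s.

Lemma ray_prod_cons c w s :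
  ray_prod c (w :: s) = op_comp (ray_op w (c w)) (ray_prod c s).
Proof. by []. Qed.

Definition normalized c := forall w, c w 0%N = 1.

Lemma unipotent_prod c s : normalized c -> all ray_dir s -> unipotent (ray_prod c s).
Proof.
move=> c0; elim: s => /= [|w s IH]; first by move=> _; apply: unipotent_id.
by case/andP=> hw hs; apply: unipotent_comp; [apply: unipotent_ray | apply: IH].
Qed.

Lemma ray_prod_quad c s : all ray_dir s -> op_supp quad (ray_prod c s).
Proof.
elim: s => /= [|w s IH]; first by move=> _; apply: op_id_quad.
case/andP=> hw hs; apply: op_comp_quad; last exact: IH.
exact: (ray_op_quad (ray_dir_quad hw)).
Qed.

Lemma ray_prod_eqdeg e k c d s : normalized c -> normalized d -> all ray_dir s ->
    (forall w (i : nat), w \in s -> i%:Z * opdeg e w < k -> c w i = d w i) ->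
  eqdeg e k (ray_prod c s) (ray_prod d s).
Proof.
move=> c0 d0; elim: s => /= [_ _ v u _|w s IH /andP[hw hs] cd]; first exact: erefl.
have q F := ray_op_quad (F := F) (ray_dir_quad hw).
apply: (eqdeg_comp (q _) (q _) (ray_prod_quad hs) (ray_prod_quad hs)).
  by apply: (ray_op_eqdeg hw (c0 w) (d0 w)) => i; apply: cd; rewrite mem_head.
by apply: IH hs _ => w' i w's; apply: cd; rewrite in_cons w's orbT.
Qed.

Lemma ray_prod_diff_sum J c d s v w : normalized c -> normalized d ->
    all ray_dir s -> 0 < J -> w.2 - v.2 = J ->
    (forall x (i : nat), x \in s -> i%:Z * x.2 < J -> c x i = d x i) ->
  ray_prod c s v w - ray_prod d s v w =
  \sum_(x <- s) (ray_op x (c x) v w - ray_op x (d x) v w).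
Proof.
move=> c0 d0 + J0 vw; elim: s => [|x s IH] /=; first by rewrite big_nil subrr.
case/andP=> hx hs cd; have cd' y (i : nat) : y \in s -> i%:Z * y.2 < J -> c y i = d y i.
  by move=> ys; apply: cd; rewrite in_cons ys orbT.
rewrite (op_comp_diff (unipotent_ray hx (c0 x)) (unipotent_ray hx (d0 x))
  (unipotent_prod c0 hs) (unipotent_prod d0 hs) _ _ J0 vw).
- by rewrite (IH hs cd') big_cons.
- apply: (ray_op_eqdeg hx (c0 x) (d0 x)) => i.
  by rewrite opdeg0; apply: cd; rewrite mem_head.
- by apply: (ray_prod_eqdeg c0 d0 hs) => y i ys; rewrite opdeg0; apply: cd'.
Qed.

(** If the first differences between two families of series occur at degree J in
    y, the difference of the coefficients n of the series of x, with n x_2 = J, can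
    be read off the products on a monomial z^v with det(x, v) <> 0: among the monomials of degree
    J, only multiples of x see the series of x. *)
Lemma ray_prod_diff J c d s x n v : normalized c -> normalized d ->
    all ray_dir s -> uniq s -> x \in s -> (0 < n)%N -> n%:Z * x.2 = J ->
    (forall y (i : nat), y \in s -> i%:Z * y.2 < J -> c y i = d y i) ->
  ray_prod c s v (v + x *+ n) - ray_prod d s v (v + x *+ n) =
  (c x n - d x n) *~ det x v.
Proof.
move=> c0 d0 hs us xs n0 xJ cd; have hx := allP hs _ xs.
have J0 : 0 < J by case/and3P: hx => _ x0 _; rewrite -xJ mulr_gt0.
rewrite (@ray_prod_diff_sum J) //; last first.
  by rewrite natmul_pair /= -mulr_natl natz xJ addrC addKr.
rewrite (bigD1_seq x) //= big1_seq ?addr0.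
  have cop := ray_dir_coprime hx.
  rewrite (ray_opE (c x) v n cop) (ray_opE (d x) v n cop).
  apply: (fps_expz_diff _ (c0 x) (d0 x) n0) => i lt_in.
  by apply: cd => //; case/and3P: hx => _ x0 _; rewrite -xJ ltr_pM2r.
move=> y /andP[yx ys]; rewrite !ray_op0 ?subrr // => m /addrI e.
  by move/eqP: yx => []; apply/esym; apply: (ray_dir_eq hx (allP hs _ ys) n0 e).
by move/eqP: yx => []; apply/esym; apply: (ray_dir_eq hx (allP hs _ ys) n0 e).
Qed.

Lemma ray_prod_filter e k c s (p : pred (int * int)) : all ray_dir s ->
    (forall w, w \in s -> ~~ p w -> eqdeg e k (ray_op w (c w)) op_id) ->
  eqdeg e k (ray_prod c s) (ray_prod c (filter p s)).
Proof.
elim: s => //= w s IH /andP[hw hs] triv.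
have qw := ray_op_quad (F := c w) (ray_dir_quad hw).
have qf : op_supp quad (ray_prod c (filter p s)).
  by apply: ray_prod_quad; rewrite all_filter; apply: sub_all hs => x /= ->; rewrite implybT.
have IHs : eqdeg e k (ray_prod c s) (ray_prod c (filter p s)).
  by apply: IH => // x xs; apply: triv; rewrite in_cons xs orbT.
case: ifPn => pw /=.
  by apply: eqdeg_comp => //; apply: ray_prod_quad.
rewrite -[X in eqdeg _ _ _ X]op_comp_idl; apply: eqdeg_comp => //.
- exact: op_id_quad.
- exact: ray_prod_quad.
- by apply: triv; rewrite ?mem_head.
Qed.

Lemma ray_prod_filter1 c s (p : pred (int * int)) : all ray_dir s ->
    (forall w, w \in s -> ~~ p w -> c w = 1) ->
  ray_prod c s = ray_prod c (filter p s).
Proof.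
elim: s => //= w s IH /andP[hw hs] triv.
have IHs : ray_prod c s = ray_prod c (filter p s).
  by apply: IH => // x xs; apply: triv; rewrite in_cons xs orbT.
case: ifPn => pw /=; first by rewrite IHs.
by rewrite triv ?mem_head // ray_op1 ?ray_dir_coprime // op_comp_idl.
Qed.

Lemma ray_prod_rcons c s w : all ray_dir s -> ray_dir w ->
  ray_prod c (rcons s w) = op_comp (ray_prod c s) (ray_op w (c w)).
Proof.
move=> + hw; elim: s => /= [_|x s IH /andP[hx hs]].
  by rewrite op_comp_idl op_comp_idr.
rewrite IH // op_compA //; first exact: (ray_op_quad (ray_dir_quad hx)).
  exact: ray_prod_quad.
exact: (ray_op_quad (ray_dir_quad hw)).
Qed.

(** The inverse of an ordered product is the product of the inverses in the
    reverse order. *)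
Lemma ray_prod_rev c s : normalized c -> all ray_dir s ->
  op_comp (ray_prod (fun w => (c w)^-1) s) (ray_prod c (rev s)) = op_id /\
  op_comp (ray_prod c (rev s)) (ray_prod (fun w => (c w)^-1) s) = op_id.
Proof.
move=> c0; elim: s => /= [_|w s IH /andP[hw hs]]; first by rewrite op_comp_idl.
have [IH1 IH2] := IH hs.
have [i1 i2] := ray_op_inv (ray_dir_coprime hw) (c0 w).
have hr : all ray_dir (rev s) by rewrite all_rev.
have q1 := ray_op_quad (F := c w) (ray_dir_quad hw).
have q2 := ray_op_quad (F := (c w)^-1) (ray_dir_quad hw).
have q3 := ray_prod_quad (c := c) hr.
have q4 := ray_prod_quad (c := fun w => (c w)^-1) hs.
rewrite rev_cons (ray_prod_rcons c hr hw); split.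
  rewrite -(op_compA q2 q4 (op_comp_quad q3 q1)).
  by rewrite (op_compA q4 q3 q1) IH1 op_comp_idl.
rewrite -(op_compA q3 q1 (op_comp_quad q2 q4)).
by rewrite (op_compA q1 q2 q4) i1 op_comp_idl.
Qed.

Lemma ray_prod_conj h c s : reflection h -> normalized c ->
    all ray_dir s -> all ray_dir (map h s) ->
  op_conj h (ray_prod c s) = ray_prod (fun w => (c (h w))^-1) (map h s).
Proof.
move=> hR c0; have [_ hK _] := hR.
elim: s => /= [_ _|w s IH /andP[hw hs] /andP[hw' hs']]; first exact: op_conj_id.
rewrite op_conj_comp // IH // hK op_conj_ray ?ray_dir_coprime //.
Qed.

End Products.
(** * Uniqueness of the ordered factorization *)

Lemma slope_gt_trans : {in ray_dir & &, transitive slope_gt}.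
Proof.
move=> [b1 b2] [a1 a2] [c1 c2] /and3P[/= ? ? _] /and3P[/= ? ? _] /and3P[/= ? ? _].
rewrite /slope_gt /= => h1 h2.
have e1 : c2 * (b2 * a1) < c2 * (a2 * b1) by rewrite ltr_pM2l.
have e2 : a2 * (c2 * b1) < a2 * (b2 * c1) by rewrite ltr_pM2l.
by rewrite -(ltr_pM2l (x := b2)) //; lia.
Qed.

Lemma slope_gt_irr : {in ray_dir, irreflexive slope_gt}.
Proof. by move=> w _; rewrite /slope_gt ltxx. Qed.

Lemma slope_gt_uniq s : all ray_dir s -> sorted slope_gt s -> uniq s.
Proof.
move=> hs; apply: sorted_uniq_in; last by move=> x /(allP hs) hx; apply: slope_gt_irr.
by move=> x y z /(allP hs) hx /(allP hs) hy /(allP hs) hz; apply: slope_gt_trans.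
Qed.

Lemma slope_gt_eq s t : all ray_dir s -> all ray_dir t ->
  sorted slope_gt s -> sorted slope_gt t -> s =i t -> s = t.
Proof.
move=> hs ht ss st est.
apply: (irr_sorted_eq_in (leT := slope_gt)) => //.
- by move=> x y z /(allP hs) hx /(allP hs) hy /(allP hs) hz; apply: slope_gt_trans.
- by move=> x /(allP hs) hx; apply: slope_gt_irr.
Qed.

Lemma slope_filter s (p : pred (int * int)) : all ray_dir s ->
  sorted slope_gt s -> sorted slope_gt (filter p s).
Proof.
move=> hs; apply: sorted_filter_in; last exact: hs.
exact: slope_gt_trans.
Qed.

(** The total preorder used to merge two slope-ordered lists. *)
Definition slope_ge (v w : int * int) := v.2 * w.1 >= w.2 * v.1.

Lemma slope_ge_trans : {in ray_dir & &, transitive slope_ge}.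
Proof.
move=> [b1 b2] [a1 a2] [c1 c2] /and3P[/= ? ? _] /and3P[/= ? ? _] /and3P[/= ? ? _].
rewrite /slope_ge /= => h1 h2.
have e1 : c2 * (b2 * a1) <= c2 * (a2 * b1) by rewrite ler_pM2l.
have e2 : a2 * (c2 * b1) <= a2 * (b2 * c1) by rewrite ler_pM2l.
by rewrite -(ler_pM2l (x := b2)) //; lia.
Qed.

Lemma slope_inj v w : ray_dir v -> ray_dir w ->
  v.2 * w.1 = w.2 * v.1 -> v = w.
Proof.
move=> hv hw e; have [/and3P[_ v0 _] /and3P[_ w0 _]] := (hv, hw).
apply: (ray_dir_eq (n := `|w.2|%N) (m := `|v.2|%N) hv hw); first by lia.
have nat_mul (x : int) n : x *+ n = x * n%:Z by rewrite -mulr_natr natz.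
by rewrite !natmul_pair !nat_mul; congr (_, _); lia.
Qed.

Lemma slope_sort m : all ray_dir m -> uniq m -> sorted slope_gt (sort slope_ge m).
Proof.
move=> hm um; have hs : all ray_dir (sort slope_ge m) by rewrite all_sort.
have us : uniq (sort slope_ge m) by rewrite sort_uniq.
have ss : sorted slope_ge (sort slope_ge m).
  by apply: (sort_sorted_in (P := ray_dir)) => // v w _ _; apply: le_total.
rewrite (sorted_pairwise_in slope_gt_trans hs).
rewrite (sorted_pairwise_in slope_ge_trans hs) in ss.
rewrite uniq_pairwise in us.
have := conj us ss; move/andP; rewrite -pairwise_relI.
apply: (sub_in_pairwise (P := ray_dir)) => // v w hv hw /= /andP[vw].
rewrite /slope_ge /slope_gt le_eqVlt => /orP[/eqP e|//].
by move/eqP: vw => []; apply: slope_inj.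
Qed.

(** Two slope-ordered lists of directions are sublists of a common one. *)
Lemma slope_merge s t : all ray_dir s -> all ray_dir t ->
    sorted slope_gt s -> sorted slope_gt t ->
  exists m, [/\ all ray_dir m, sorted slope_gt m,
    filter (mem s) m = s & filter (mem t) m = t].
Proof.
move=> hs ht ss st; pose m := sort slope_ge (undup (s ++ t)).
have mE : m =i s ++ t by move=> w; rewrite mem_sort mem_undup.
have hm : all ray_dir m.
  by apply/allP => w; rewrite mE mem_cat => /orP[/(allP hs)|/(allP ht)].
have sm : sorted slope_gt m.
  apply: slope_sort; last exact: undup_uniq.
  by apply/allP => w; rewrite mem_undup mem_cat => /orP[/(allP hs)|/(allP ht)].
have sub r : {subset r <= m} -> all ray_dir r -> sorted slope_gt r ->
    filter (mem r) m = r.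
  move=> rm hr sr; apply: slope_gt_eq => //; last 1 first.
  - by move=> w; rewrite mem_filter /= andb_idr //; apply: rm.
  - by rewrite all_filter; apply: sub_all hm => w /= ->; rewrite implybT.
  - exact: slope_filter.
exists m; split=> //; apply: sub => // w wr; rewrite mE mem_cat wr ?orbT //.
Qed.

Section Uniqueness.
Variable K : numFieldType.
Implicit Types (c d : int * int -> fps K) (s t : seq (int * int)).

Lemma det_10_neq0 w : ray_dir w -> det w (1, 0) != 0.
Proof. by case: w => a b /and3P[/= _ b0 _]; rewrite /det /=; lia. Qed.

(** A slope-ordered factorization is determined, below degree J in y, by the image
    of the monomial x. *)
Lemma ray_prod_inj (J : int) c d s t : normalized c -> normalized d ->
    all ray_dir s -> all ray_dir t -> sorted slope_gt s -> sorted slope_gt t ->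
    (forall w (i : nat), ray_dir w -> w \notin s -> (0 < i)%N ->
       i%:Z * w.2 < J -> c w i = 0) ->
    (forall w (i : nat), ray_dir w -> w \notin t -> (0 < i)%N ->
       i%:Z * w.2 < J -> d w i = 0) ->
    (forall u : int * int, u.2 < J -> ray_prod c s (1, 0) u = ray_prod d t (1, 0) u) ->
  forall w (i : nat), ray_dir w -> i%:Z * w.2 < J -> c w i = d w i.
Proof.
move=> c0 d0 hs ht ss st cs dt cd.
have [m [hm sm ms mt]] := slope_merge hs ht ss st.
have um := slope_gt_uniq hm sm.
have Em (e : int * int -> fps K) (r : seq (int * int)) : normalized e -> filter (mem r) m = r ->
    (forall w (i : nat), ray_dir w -> w \notin r -> (0 < i)%N ->
       i%:Z * w.2 < J -> e w i = 0) ->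
    eqdeg 0 J (ray_prod e m) (ray_prod e r).
  move=> e0 {2}<- er; apply: ray_prod_filter => // w wm wr.
  have hw := allP hm _ wm; apply: (ray_op_eqdeg1 hw (e0 w)) => i i0.
  by rewrite opdeg0; apply: er.
have cdm (u : int * int) : u.2 < J -> ray_prod c m (1, 0) u = ray_prod d m (1, 0) u.
  move=> uJ; have u1 : opdeg 0 (u - (1, 0)) < J by rewrite opdeg0 /= subr0.
  by rewrite (Em c s c0 ms cs _ _ u1) (Em d t d0 mt dt _ _ u1) cd.
suff main (N : nat) (w : int * int) (i : nat) : w \in m -> i%:Z * w.2 <= N%:Z ->
    i%:Z * w.2 < J -> c w i = d w i.
  move=> w i hw iJ; have w0 : 0 < w.2 by case/and3P: hw.
  have [wm|wm] := boolP (w \in m).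
    by apply: (main `|(i%:Z * w.2)%R|%N w i wm _ iJ); rewrite gez0_abs // mulr_ge0 // ltW.
  case: i iJ => [|i] iJ; first by rewrite c0 d0.
  have notin r : filter (mem r) m = r -> w \notin r.
    by move=> mr; apply: contra wm; rewrite -mr mem_filter => /andP[].
  by rewrite (cs w) ?(dt w) // notin.
elim: N w i => [|N IH] w i wm iN iJ; have w0 : 0 < w.2 by case/and3P: (allP hm _ wm).
  have -> : i = 0%N by case: i iN {iJ} => // i; nia.
  exact: etrans (c0 w) (esym (d0 w)).
have [iN'|iN'] := leP (i%:Z * w.2) N%:Z; first exact: IH.
have i0 : (0 < i)%N by case: i iN' {iN iJ} => //; lia.
have E : ray_prod c m (1, 0) ((1, 0) + w *+ i) = ray_prod d m (1, 0) ((1, 0) + w *+ i).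
  by apply: cdm; rewrite natmul_pair /= add0r -mulr_natl natz.
have := ray_prod_diff (1, 0) c0 d0 hm um wm i0 erefl _; rewrite E subrr => D.
have /esym/eqP : 0 = (c w i - d w i) *~ det w (1, 0).
  apply: D => y k ym kJ; apply: (IH y k ym); last exact: lt_trans kJ iJ.
  by have := lt_le_trans kJ iN; rewrite -addn1 PoszD ltzD1.
by rewrite mulrz_eq0 (negbTE (det_10_neq0 (allP hm _ wm))) orFb subr_eq0 => /eqP.
Qed.

End Uniqueness.
(** * The shear, the swap, and the cone of exponents *)

Lemma Posz_absS (x : int) : 0 <= x -> (`|x|.+1)%:Z = x + 1.
Proof. by lia. Qed.

Lemma quad_primitive_ray w : quad_primitive w -> ray_dir w.
Proof. by case/andP=> /andP[w1 w2] cop; rewrite /ray_dir ltW // w2. Qed.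

Lemma ray_dir_cases w : ray_dir w -> w = (0, 1) \/ quad_primitive w.
Proof.
case: w => a b /and3P[/= a0 b0 cop]; move: a0; rewrite le_eqVlt => /orP[/eqP e|a0].
  left; move: cop; rewrite -e /coprimez gcd0z => /eqP [b1].
  by congr (_, _); lia.
by right; rewrite /quad_primitive /in_quadrant /= a0 b0.
Qed.

(** The involution (a, b) |-> (l b - a, b). *)
Definition shear (l : nat) (w : int * int) : int * int := (l%:Z * w.2 - w.1, w.2).

(** The involution (a, b) |-> (b, a). *)
Definition swap (w : int * int) : int * int := (w.2, w.1).

Lemma swap_reflection : reflection swap.
Proof.
split=> [[a b] [c d]|[a b]|[a b] [c d]] //.
by rewrite /det /=; ring.
Qed.

Lemma shear_reflection l : reflection (shear l).
Proof.
split=> [[a b] [c d]|[a b]|[a b] [c d]]; rewrite /shear /det /=.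
- by congr (_, _) => /=; ring.
- by congr (_, _); ring.
- by ring.
Qed.

Lemma shear_coprime l w : coprimez (shear l w).1 (shear l w).2 = coprimez w.1 w.2.
Proof.
case: w => a b; rewrite /coprimez /=.
by rewrite gcdzC gcdzMDl gcdzN gcdzC.
Qed.

(** The exponents (a, b) with 0 <= a <= l b; the shear preserves this cone. *)
Definition cone (l : nat) (m : int * int) := [&& 0 <= m.1, 0 <= m.2 & m.1 <= l%:Z * m.2].

Lemma coneD l m n : cone l m -> cone l n -> cone l (m + n).
Proof.
case: m n => a b [c d] /and3P[/= ? ? ?] /and3P[/= ? ? ?].
by rewrite /cone /= mulrDr !addr_ge0 //= lerD.
Qed.

Lemma cone_quad l m : cone l m -> quad m.
Proof. by case/and3P=> h1 h2 _; apply/andP. Qed.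

Lemma cone_shear l m : cone l (shear l m) = cone l m.
Proof. by case: m => a b; rewrite /cone /=; apply/and3P/and3P => -[? ? ?]; split; lia. Qed.

Lemma coneMn l m n : cone l m -> cone l (m *+ n).
Proof.
move=> cm; elim: n => [|n IH]; first by rewrite mulr0n /cone /= mulr0 lexx.
by rewrite mulrS coneD.
Qed.

Lemma cone_ray l w n : ray_dir w -> (0 < n)%N -> cone l (w *+ n) = cone l w.
Proof.
case: w => a b /and3P[/= a0 b0 _] n0; rewrite natmul_pair /cone /=.
rewrite -(mulr_natl a) -(mulr_natl b) natz mulrCA ler_pM2l //.
by rewrite a0 (ltW b0) !mulr_ge0 // ltW.
Qed.

Lemma shear_ray l w : ray_dir w -> cone l w -> ray_dir (shear l w).
Proof.
case/and3P => _ w2 cop /and3P[_ _ w1].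
by rewrite /ray_dir shear_coprime cop /= w2 subr_ge0 w1.
Qed.

Lemma slope_gt_shear l v w : slope_gt (shear l w) (shear l v) = slope_gt v w.
Proof. by rewrite /slope_gt /=; apply/idP/idP; lia. Qed.

Section OnePlus.
Variable K : fieldType.

(** The series 1 + z. *)
Definition fps_1T : fps K := 1 + fpsT.

Lemma fps_1TX n k : (fps_1T ^+ n) k = 'C(n, k)%:R.
Proof.
have S (F : fps K) i : (fps_1T * F) i.+1 = F i.+1 + F i.
  rewrite mulrDl mul1r fpsD; congr (_ + _).
  rewrite fpsM !big_ord_recl /= mul0r add0r mul1r subSS subn0 big1 ?addr0 //.
  by move=> j _; rewrite /= mul0r.
have S0 (F : fps K) : (fps_1T * F) 0%N = F 0%N.
  by rewrite fpsM big_ord1 /= addr0 mul1r.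
elim: n k => [|n IH] k; first by rewrite expr0 fps1 bin0n eq_sym.
rewrite exprS; case: k => [|k]; first by rewrite S0 IH !bin0.
by rewrite S !IH binS natrD.
Qed.

Lemma fps_1TX0 n : (fps_1T ^+ n) 0%N = 1.
Proof. by rewrite fps_1TX bin0. Qed.

End OnePlus.

(** The commutator factorization for operators, written S o T = T o P o S with P
    the ordered product of the ray operators. It is required modulo each total
    degree k, for a finite product P that contains all the nontrivial
    directions. *)
Definition op_factorization (K : fieldType) (l1 l2 : nat) (c : int * int -> fps K) :=
  let S := ray_op (1, 0) (fps_1T K ^+ l1) in
  let T := ray_op (0, 1) (fps_1T K ^+ l2) in
  forall k : nat, exists s : seq (int * int),
    [/\ all quad_primitive s, sorted slope_gt s,
        forall w (i : nat), quad_primitive w -> w \notin s -> (0 < i)%N ->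
          i%:Z * (w.1 + w.2) < k%:Z -> c w i = 0
      & eqdeg 1 k (op_comp S T) (op_comp (op_comp T (ray_prod c s)) S)].

Section Rows.
Variable K : fieldType.
Implicit Types A B : int * int -> int * int -> K.

Lemma ray_prod_eq_in (c d : int * int -> fps K) s :
  {in s, c =1 d} -> ray_prod c s = ray_prod d s.
Proof.
elim: s => [_|w s IH cd] /=; first exact: erefl.
have cd' : {in s, c =1 d} by move=> x xs; apply: cd; rewrite in_cons xs orbT.
by rewrite (cd w (mem_head w s)) (IH cd').
Qed.

(** Agreement on the monomials x^i y^j with j >= 0, on which S acts polynomially. *)
Definition eqrow A B := forall v u, 0 <= v.2 -> A v u = B v u.

Lemma eqrow_comp A A' B : op_supp quad B ->
  eqrow A A' -> eqrow (op_comp A B) (op_comp A' B).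
Proof.
move=> sB AA' v w v0; rewrite !op_compEsum.
suff pt (u : int * int) : B v u * A u w = B v u * A' u w.
  by apply: eq_fsbigr => u _; apply: pt.
have [->|/sB] := eqVneq (B v u) 0; first by rewrite !mul0r.
by rewrite quadB => /andP[_ vu]; rewrite AA' // (le_trans v0).
Qed.

Lemma eqrow_compl A B B' : eqrow B B' -> eqrow (op_comp A B) (op_comp A B').
Proof. by move=> BB' v w v0; rewrite !op_compEsum; apply: eq_fsbigr => u _; rewrite BB'. Qed.

Lemma ray_prod_cone l (c : int * int -> fps K) s : all ray_dir s ->
    (forall w, w \in s -> ~~ cone l w -> c w = 1) ->
  op_supp (cone l) (ray_prod c s).
Proof.
have c0 : cone l 0 by rewrite /cone /= mulr0 lexx.
elim: s => /= [_ _|w s IH /andP[hw hs] triv]; first exact: op_id_supp.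
apply: op_comp_supp; first by move=> m n; apply: coneD.
  have [cw|ncw] := boolP (cone l w).
    by apply: ray_op_supp => n; apply: coneMn.
  rewrite triv ?mem_head // ray_op1 ?ray_dir_coprime //; exact: op_id_supp.
by apply: IH => // x xs; apply: triv; rewrite in_cons xs orbT.
Qed.

End Rows.
(** * Invariance under the shear *)

Section Core.
Variables (K : numFieldType) (l1 l2 : nat) (c : int * int -> fps K).
Hypothesis c0 : normalized c.
Hypothesis fact_c : op_factorization l1 l2 c.

Let F1 : fps K := fps_1T K ^+ l1.
Let F2 : fps K := fps_1T K ^+ l2.
Let F10 : F1 0%N = 1. Proof. exact: fps_1TX0. Qed.
Let F20 : F2 0%N = 1. Proof. exact: fps_1TX0. Qed.
(* Si and Ti are the inverses of S and T. *)
Variables S Si T Ti : int * int -> int * int -> K.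
Hypotheses (defS : S = ray_op (1, 0) F1) (defSi : Si = ray_op (1, 0) F1^-1).
Hypotheses (defT : T = ray_op (0, 1) F2) (defTi : Ti = ray_op (0, 1) F2^-1).

Let cop10 : coprimez (1 : int, 0 : int).1 (1 : int, 0 : int).2. Proof. by []. Qed.
Let cop01 : coprimez (0 : int, 1 : int).1 (0 : int, 1 : int).2. Proof. by []. Qed.
Let sS : op_supp quad S. Proof. by rewrite defS; apply: ray_op_quad. Qed.
Let sSi : op_supp quad Si. Proof. by rewrite defSi; apply: ray_op_quad. Qed.
Let sT : op_supp quad T. Proof. by rewrite defT; apply: ray_op_quad. Qed.
Let sTi : op_supp quad Ti. Proof. by rewrite defTi; apply: ray_op_quad. Qed.

Let SSi : op_comp S Si = op_id.
Proof. rewrite defS defSi; exact: (ray_op_inv cop10 F10).1. Qed.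
Let SiS : op_comp Si S = op_id.
Proof. rewrite defS defSi; exact: (ray_op_inv cop10 F10).2. Qed.
Let TiT : op_comp Ti T = op_id.
Proof. rewrite defT defTi; exact: (ray_op_inv cop01 F20).2. Qed.

(* The factor T is the ray operator of (0, 1), with series F2: cc is the family
   of the resulting ordered factorization of U = S o T o S^-1. *)
Let cc (w : int * int) : fps K :=
  if w == (0, 1) then F2 else if quad_primitive w then c w else 1.

Let cc0 : normalized cc.
Proof.
move=> w; rewrite /cc; case: ifP => _; first exact: F20.
case: ifP => _; [exact: c0 | exact: fps1].
Qed.

Let U := op_comp (op_comp S T) Si.

Let sST : op_supp quad (op_comp S T). Proof. exact: op_comp_quad. Qed.
Let sU : op_supp quad U. Proof. exact: op_comp_quad. Qed.

Let U_S : op_comp U S = op_comp S T.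
Proof. by rewrite /U -(op_compA sST sSi sS) SiS op_comp_idr. Qed.

Let U_prod (k : nat) : exists s,
  [/\ all ray_dir s, sorted slope_gt s,
      forall w (i : nat), ray_dir w -> w \notin s -> (0 < i)%N ->
        i%:Z * (w.1 + w.2) < k%:Z -> cc w i = 0
    & eqdeg 1 k U (ray_prod cc s)].
Proof.
have [s [ps ss triv]] := fact_c k; rewrite -/F1 -/F2 -defS -defT => eqs.
have hs : all ray_dir s by apply: sub_all ps => w; apply: quad_primitive_ray.
have ccE : {in s, cc =1 c}.
  move=> w ws; have pw := allP ps _ ws; rewrite /cc pw ifN //.
  by apply/eqP => w01; move: pw; rewrite w01.
exists ((0, 1) :: s); split.
- by rewrite /= hs.
- case: s ss ps {hs triv eqs ccE} => //= w s -> /andP[/andP[/andP[w1 w2] _] _].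
  by rewrite /slope_gt /= mul1r mulr0 w1.
- move=> w i hw; rewrite in_cons negb_or => /andP[w01 ws] i0 ik.
  have [/eqP|pw] := ray_dir_cases hw; first by rewrite (negbTE w01).
  by rewrite /cc (negbTE w01) pw; apply: triv.
- have sP := ray_prod_quad (c := c) hs.
  have sTP := op_comp_quad sT sP.
  rewrite ray_prod_cons (ray_prod_eq_in ccE) /cc eqxx -defT.
  have -> : op_comp T (ray_prod c s) =
      op_comp (op_comp (op_comp T (ray_prod c s)) S) Si.
    by rewrite -(op_compA sTP sS sSi) SSi op_comp_idr.
  by apply: (eqdeg_comp sST (op_comp_quad sTP sS) sSi sSi eqs).
Qed.

Let comp_ST (F : fps K) (v w : int * int) :
  op_comp S (ray_op (0, 1) F) v w =
  ray_op (0, 1) F v (v.1, w.2) * S (v.1, w.2) w.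
Proof.
rewrite op_compEsum (fsbigTE [fset (v.1, w.2)]%fset) ?big_seq_fset1 //.
suff pt (x : int * int) : x \notin [fset (v.1, w.2)]%fset ->
    ray_op (0, 1) F v x * S x w = 0 by exact: pt.
rewrite inE => nx; case: (rayP (0, 1) v x) => [n xE|off]; last first.
  by rewrite ray_op0 ?mul0r.
case: (rayP (1, 0) x w) => [m wE|off]; last by rewrite mulrC defS ray_op0 ?mul0r.
case/negP: nx; rewrite wE xE !natmul_pair; apply/eqP; case: (v) => a b.
by congr (_, _); rewrite /= mul0rn addr0.
Qed.

Let S_row0 v w : v.2 = 0 -> S v w = op_id v w.
Proof.
rewrite defS /op_id => v2; case: (rayP (1, 0) v w) => [n ->|off].
  rewrite ray_opE // /det v2 mul0r mulr0 subrr expr0z fps1.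
  rewrite -[X in _ = (X == _)%:R]addr0 (inj_eq (addrI v)) eq_sym.
  by rewrite -(mulr0n (1, 0)) (inj_eq (mulrIn_pair (coprimez_neq0 cop10))).
rewrite ray_op0 //; case: eqP => // e; case: (off 0%N).
by rewrite e mulr0n addr0.
Qed.

Let S_E (v w : int * int) : 0 <= v.2 -> S v w =
  if (w.2 == v.2) && (v.1 <= w.1) then 'C(l1 * `|v.2|, `|(w.1 - v.1)%R|)%:R else 0.
Proof.
move=> v2; rewrite defS; case: (rayP (1, 0) v w) => [n ->|off].
  rewrite ray_opE // natmul_pair /= mul0rn addr0 eqxx lerDl mulrn_wge0 //=.
  have -> : det (1, 0) v = `|v.2|%N by rewrite /det /= mul1r mul0r subr0 gez0_abs.
  rewrite -exprnP /F1 -exprM fps_1TX.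
  by rewrite addrC addKr -[1 *+ n]/(n%:R) natz absz_nat.
rewrite ray_op0 //; case: ifP => // /andP[/eqP e1 e2].
case: (off `|(w.1 - v.1)%R|%N).
rewrite natmul_pair /= mul0rn [1 *+ _](natz `|(w.1 - v.1)%R|%N) gez0_abs ?subr_ge0 //.
by case: (w) (v) e1 => [a b] [a' b'] /= ->; congr (_, _) => /=; ring.
Qed.

(* The binomial symmetry: S is invariant under (v, w) |-> (sigma v, shear w),
   where sigma (a, b) = (-a, b), on the rows with b >= 0. *)
Let S_sym (v w : int * int) : 0 <= v.2 -> S v w = S (- v.1, v.2) (shear l1 w).
Proof.
move=> v2; rewrite !S_E //=; case: eqP => //= wv; rewrite wv opprK.
set i := w.1 - v.1; pose n := (l1 * `|v.2|)%N.
have nE : n%:Z = l1%:Z * v.2 by rewrite PoszM gez0_abs.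
have -> : l1%:Z * v.2 - w.1 + v.1 = n%:Z - i by rewrite nE /i; ring.
have -> : (v.1 <= w.1) = (0 <= i) by rewrite subr_ge0.
have -> : (- v.1 <= l1%:Z * v.2 - w.1) = (i <= n%:Z) by rewrite nE /i; lia.
rewrite -/n; case: (lerP 0 i) => i0; case: (lerP i n%:Z) => iN //.
- rewrite -bin_sub; last by lia.
  by congr (_%:R); congr ('C(_, _)); lia.
- by rewrite bin_small //; lia.
- by rewrite bin_small //; lia.
Qed.

(* U x = S T x = x (1 + y (1 + x)^l1)^(-l2), since S fixes x. *)
Let U_row0 (u : int * int) : ~~ cone l1 (u - (1, 0)) -> U (1, 0) u = 0.
Proof.
move=> ncu; have <- : op_comp U S (1, 0) u = U (1, 0) u.
  rewrite -[in RHS](op_comp_idr U) !op_compEsum; apply: eq_fsbigr => x _.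
  by rewrite S_row0.
rewrite U_S defT comp_ST; case: (rayP (0, 1) (1, 0) (1, u.2)) => [n e|off]; last first.
  by rewrite ray_op0 ?mul0r.
have u2 : 0 <= u.2.
  by move: e; rewrite natmul_pair /= => -[_ ->]; rewrite add0r mulrn_wge0.
rewrite S_E //= eqxx /=; case: ifP => u1; last by rewrite mulr0.
rewrite bin_small ?mulr0 //.
move: ncu; rewrite /cone /= subr0 subr_ge0 u1 u2 /= -ltNge; lia.
Qed.

(* By induction on the degree in y: truncating the family to the cone gives a
   product supported in the cone, and U x only involves exponents in the cone,
   so no first difference can occur outside of it. *)
Let cc_cone w : ~~ cone l1 w -> cc w = 1.
Proof.
suff main (N : nat) (x : int * int) (i : nat) : ray_dir x -> ~~ cone l1 x -> (0 < i)%N ->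
    i%:Z * x.2 <= N%:Z -> cc x i = 0.
  move=> ncw; have [hw|nhw] := boolP (ray_dir w); last first.
    rewrite /cc; case: eqP => [e|_]; first by rewrite e in nhw.
    by case: ifP => // /quad_primitive_ray; rewrite (negbTE nhw).
  apply: fpsP => -[|i]; first exact: etrans (cc0 w) (esym (fps1 _ 0)).
  rewrite fps1; apply: (main `|(i.+1%:Z * w.2)%R|%N) => //.
  by rewrite gez0_abs // mulr_ge0 //; case/and3P: hw => _ /ltW.
elim: N x i => [|N IH] w' i hw ncw i0 iN.
  by case/and3P: hw => _ w2 _; move: iN; rewrite leNgt mulr_gt0.
have [s [hs ss triv eqs]] := U_prod `|(i%:Z * (w'.1 + w'.2))%R|.+1.
have wdeg : 0 <= w'.1 + w'.2 by case/and3P: hw => h /ltW h' _; rewrite addr_ge0.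
have kE : (`|(i%:Z * (w'.1 + w'.2))%R|.+1)%:Z = i%:Z * (w'.1 + w'.2) + 1.
  by rewrite -addn1 PoszD gez0_abs // mulr_ge0.
have [ws|ws] := boolP (w' \in s); last first.
  by apply: (triv w' i hw ws i0); rewrite kE ltzD1.
pose d w := if cone l1 w then cc w else 1.
have d0 : normalized d by move=> x; rewrite /d; case: ifP => _; [exact: cc0 | exact: fps1].
have E1 : ray_prod cc s (1, 0) ((1, 0) + w' *+ i) = 0.
  rewrite -eqs; last first.
    rewrite addrC addKr kE ltzD1 natmul_pair /opdeg /= mul1r.
    by rewrite -(mulr_natl w'.1) -(mulr_natl w'.2) natz mulrDr.
  by apply: U_row0; rewrite addrC addKr cone_ray.
have E2 : ray_prod d s (1, 0) ((1, 0) + w' *+ i) = 0.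
  apply: (op_supp_eq0 (P := cone l1)); last by rewrite addrC addKr cone_ray.
  by apply: ray_prod_cone => // x _ ncx; rewrite /d (negbTE ncx).
have := ray_prod_diff (1, 0) cc0 d0 hs (slope_gt_uniq hs ss) ws i0 erefl _.
rewrite E1 E2 subrr /d (negbTE ncw) fps1 (gtn_eqF i0) subr0 => D.
have /esym/eqP : 0 = (cc w' i) *~ det w' (1, 0).
  apply: D => y j ys jJ; case: ifP => // /negbT ncy.
  case: j jJ => [_|j jJ]; first exact: etrans (cc0 y) (esym (fps1 _ 0)).
  rewrite fps1; apply: (IH y j.+1 (allP hs _ ys) ncy) => //.
  by have := lt_le_trans jJ iN; rewrite -[N.+1]addn1 PoszD ltzD1.
by rewrite mulrz_eq0 (negbTE (det_10_neq0 hw)) orFb => /eqP.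
Qed.

Let U_cone : op_supp (cone l1) U.
Proof.
move=> v u; apply: contraNT => ncvu.
have [q|nq] := boolP (quad (u - v)); last by rewrite (op_supp_eq0 sU).
have [s [hs _ _ eqs]] := U_prod `|opdeg 1 (u - v)|.+1.
rewrite eqs; last by rewrite Posz_absS ?opdeg_ge0 // ltzD1.
apply/eqP/(op_supp_eq0 (P := cone l1)) => //.
by apply: ray_prod_cone => // x _; apply: cc_cone.
Qed.

(* The conjugate of U by the shear; it turns out to be the inverse of U. *)
Let Uh := op_conj (shear l1) U.

Let sUh : op_supp quad Uh.
Proof.
move=> v u /U_cone; rewrite -(reflectionB _ _ (shear_reflection l1)) cone_shear.
exact: cone_quad.
Qed.

Let Uh_S : eqrow (op_comp Uh S) (op_comp S Ti).
Proof.
move=> v w v2.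
have -> : op_comp Uh S v w = op_comp U S (- v.1, v.2) (shear l1 w).
  rewrite !op_compEsum [in RHS](reindex_fsbigT (shear l1)); last first.
    by apply: inv_bij; case: (shear_reflection l1).
  apply: eq_fsbigr => x _; rewrite (S_sym _ v2) /Uh /op_conj.
  by [].
have cT := comp_ST F2; rewrite -defT in cT.
have cTi := comp_ST F2^-1; rewrite -defTi in cTi.
rewrite U_S cT cTi /=.
have e1 : T (- v.1, v.2) (- v.1, w.2) = Ti v (v.1, w.2).
  case: (rayP (0, 1) v (v.1, w.2)) => [n e|off].
    have e' : (- v.1, w.2) = (- v.1, v.2) + (0, 1) *+ n.
      move: e; rewrite natmul_pair /= mul0rn => -[_ ->].
      by congr (_, _) => /=; rewrite ?addr0.
    rewrite e e' defT (ray_opE F2 _ n cop01) defTi (ray_opE F2^-1 v n cop01) exprz_inv.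
    by congr (coefs (_ ^ _) _); rewrite /det /=; ring.
  rewrite defTi (ray_op0 _ off) defT ray_op0 // => n e; apply: (off n).
  move: e; rewrite natmul_pair /= => -[_ e].
  case: (v) e => a b /= ->; congr (_, _) => /=; rewrite ?mul0rn ?addr0 //.
rewrite e1.
have [w2|w2] := lerP v.2 w.2; last first.
  by rewrite (op_supp_eq0 sTi) ?mul0r // quadB /= lexx /= -ltNge.
by rewrite [in RHS]S_sym ?(le_trans v2).
Qed.

Let Uh_U : eqrow (op_comp Uh U) op_id.
Proof.
have e1 : op_comp Uh U = op_comp (op_comp (op_comp Uh S) T) Si.
  by rewrite /U (op_compA sUh sST sSi) (op_compA sUh sS sT).
have e2 : op_comp (op_comp (op_comp S Ti) T) Si = op_id.
  by rewrite -(op_compA sS sTi sT) TiT op_comp_idr.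
move=> v w v2; rewrite e1 -[RHS](congr1 (fun A => A v w) e2).
exact: (eqrow_comp sSi (eqrow_comp sT Uh_S)).
Qed.

(* The reflected family. *)
Let cs (w : int * int) : fps K := if cone l1 w then cc (shear l1 w) else 1.

Let cs0 : normalized cs.
Proof. by move=> w; rewrite /cs; case: ifP => _; [exact: cc0 | exact: fps1]. Qed.

(** Conjugation by the shear inverts U and every ray operator, so the reflected
    family, in reverse order, factors U as well. *)
Lemma op_factorization_shear w : quad_primitive w -> quad_primitive (shear l1 w) ->
  c w = c (shear l1 w).
Proof.
have not01 x : quad_primitive x -> cc x = c x.
  by move=> px; rewrite /cc px ifN //; apply/eqP => e; rewrite e in px.
suff main x (i : nat) : ray_dir x -> cc x i = cs x i.
  move=> pw pw'; have cw : cone l1 w.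
    move: pw pw' => /andP[/andP[w1 w2] _] /andP[/andP[/= w1' _] _].
    by rewrite /cone !ltW // -subr_gt0.
  rewrite -(not01 w pw) -(not01 _ pw'); apply: fpsP => i.
  by rewrite (main w i (quad_primitive_ray pw)) /cs cw.
move=> hx; pose J : nat := (`|(i%:Z * x.2)%R|).+1.
(* In the cone, degree less than J in y forces total degree less than (l1 + 1) J. *)
have [s [hs ss triv eqs]] := U_prod (l1.+1 * J).
pose L1 := filter (cone l1) s; pose L2 := rev (map (shear l1) L1).
have cL1 : all (cone l1) L1 by exact: filter_all.
have hL1 : all ray_dir L1 by apply/allP => y; rewrite mem_filter => /andP[_ /(allP hs)].
have hL1' : all ray_dir (map (shear l1) L1).
  rewrite all_map; apply/allP => y yL; exact: shear_ray (allP hL1 _ yL) (allP cL1 _ yL).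
have hL2 : all ray_dir L2 by rewrite all_rev.
have sL1 : sorted slope_gt L1 by apply: slope_filter.
have sL2 : sorted slope_gt L2.
  rewrite rev_sorted sorted_map; apply: sub_sorted sL1 => y z.
  by rewrite /= slope_gt_shear.
have [shD shK _] := shear_reflection l1.
have Jdeg (m : int * int) : cone l1 m -> m.2 < J%:Z -> m.1 + m.2 < (l1.+1 * J)%N%:Z.
  case: m => a b /and3P[/= a0 b0 ab] bJ; rewrite PoszM.
  apply: (@le_lt_trans _ _ (l1.+1%:Z * b)).
    by rewrite -[l1.+1]addn1 PoszD mulrDl mul1r lerD2r.
  by rewrite ltr_pM2l.
have E1 : eqdeg 0 J U (ray_prod cc L1).
  move=> v u; rewrite opdeg0 => uJ.
  rewrite -(ray_prod_filter1 (c := cc) hs); last by move=> y _; apply: cc_cone.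
  have [cvu|ncvu] := boolP (cone l1 (u - v)).
    by apply: eqs; rewrite /opdeg mul1r; apply: Jdeg.
  rewrite (op_supp_eq0 U_cone) // (op_supp_eq0 (P := cone l1)) //.
  by apply: ray_prod_cone => // y _; apply: cc_cone.
have csE : {in L1, forall y, cs (shear l1 y) = cc y}.
  by move=> y yL; rewrite /cs cone_shear (allP cL1 _ yL) shK.
have E2 : eqdeg 0 J Uh (ray_prod (fun w => (cs w)^-1) (map (shear l1) L1)).
  have -> : ray_prod (fun w => (cs w)^-1) (map (shear l1) L1) =
      op_conj (shear l1) (ray_prod cc L1).
    rewrite (ray_prod_conj (shear_reflection l1) cc0 hL1 hL1'); apply: ray_prod_eq_in => y.
    case/mapP => z zL ->; congr (_^-1); rewrite shK; exact: csE.
  move=> v u; rewrite opdeg0 => vu; apply: E1.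
  by rewrite -(reflectionB _ _ (shear_reflection l1)) opdeg0.
have [QP PQ] := ray_prod_rev cs0 hL1'.
set Q := ray_prod _ _ in E2 QP PQ; rewrite -/L2 in QP PQ; set P := ray_prod _ L2 in QP PQ.
have sQ : op_supp quad Q by apply: ray_prod_quad.
have sP : op_supp quad P by apply: ray_prod_quad.
have E3 (v u : int * int) : 0 <= v.2 -> u.2 - v.2 < J%:Z -> U v u = P v u.
  move=> v2 vu; have deg : opdeg 0 (u - v) < J by rewrite opdeg0.
  rewrite -[U]op_comp_idl -PQ -(op_compA sP sQ sU).
  have -> : op_comp P (op_comp Q U) v u = op_comp P (op_comp Uh U) v u.
    apply: (eqdeg_comp (k := J) (e := 0)) => //; try exact: op_comp_quad.
    by apply: eqdeg_comp => //; apply: eqdeg_sym.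
  have h : eqrow (op_comp P (op_comp Uh U)) (op_comp P op_id) by exact: eqrow_compl Uh_U.
  by rewrite (h v u v2) op_comp_idr.
apply: (ray_prod_inj (J := J) cc0 cs0 hL1 hL2 sL1 sL2) => //.
- move=> y j hy yL j0 jJ; have [cy|ncy] := boolP (cone l1 y); last first.
    by rewrite cc_cone // fps1 gtn_eqF.
  apply: (triv y j hy _ j0).
    by apply: contra yL => ys; rewrite mem_filter cy.
  have := Jdeg _ (coneMn j cy); rewrite natmul_pair /= -(mulr_natl y.1) -(mulr_natl y.2) natz.
  by rewrite -mulrDr; apply.
- move=> y j hy yL j0 jJ; rewrite /cs; case: ifP => [cy|_]; last by rewrite fps1 gtn_eqF.
  apply: (triv _ j (shear_ray hy cy) _ j0).
    apply: contra yL => ys; rewrite mem_rev; apply/mapP; exists (shear l1 y) => //.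
    by rewrite mem_filter cone_shear cy.
  have cy' : cone l1 (shear l1 y) by rewrite cone_shear.
  have := Jdeg _ (coneMn j cy'); rewrite natmul_pair /=.
  rewrite -(mulr_natl (_ - _)) -(mulr_natl y.2) natz -mulrDr; apply.
  exact: jJ.
- move=> u uJ; have u0 : opdeg 0 (u - (1, 0)) < J by rewrite opdeg0 /= subr0.
  by rewrite -(E1 _ _ u0); apply: E3; rewrite //= subr0.
- by rewrite /J Posz_absS ?ltzD1 // mulr_ge0 //; case/and3P: hx => _ /ltW.
Qed.

End Core.

(** * Invariance under the swap *)

Lemma swap_primitive w : quad_primitive (swap w) = quad_primitive w.
Proof.
case: w => a b; rewrite /quad_primitive /in_quadrant /= coprimez_sym.
by rewrite [(0 < b) && _]andbC.
Qed.

Section Swap.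
Variables (K : fieldType).
Implicit Types A B C D P Q : int * int -> int * int -> K.

Lemma eqdeg_conj_swap k A B P A' B' P' :
    op_conj swap A = A' -> op_conj swap B = B' -> op_conj swap P = P' ->
    eqdeg 1 k (op_comp A B) (op_comp (op_comp B P) A) ->
  eqdeg 1 k (op_comp A' B') (op_comp (op_comp B' P') A').
Proof.
move=> <- <- <-; have [_ swK _] := swap_reflection; move=> AB.
rewrite -(op_conj_comp A B swK) -(op_conj_comp B P swK) -(op_conj_comp _ A swK).
move=> v u vu; apply: AB; move: vu; rewrite -(reflectionB _ _ swap_reflection).
by rewrite /opdeg /= !mul1r addrC.
Qed.

(** Inversion of both sides of A o B = B o P o A, modulo the total degree k. *)
Lemma op_comm_inv k A A' B B' P P' :
    op_supp quad A -> op_supp quad A' -> op_supp quad B -> op_supp quad B' ->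
    op_supp quad P -> op_supp quad P' ->
    op_comp A A' = op_id -> op_comp A' A = op_id ->
    op_comp B B' = op_id -> op_comp B' B = op_id -> op_comp P' P = op_id ->
    eqdeg 1 k (op_comp A B) (op_comp (op_comp B P) A) ->
  eqdeg 1 k (op_comp B' A') (op_comp (op_comp A' P') B').
Proof.
move=> sA sA' sB sB' sP sP' AA' A'A BB' B'B P'P eAB.
have sBA := op_comp_quad sB' sA'.
have sAPB := op_comp_quad (op_comp_quad sA' sP') sB'.
have := eqdeg_comp (op_comp_quad sAPB (op_comp_quad sA sB))
  (op_comp_quad sAPB (op_comp_quad (op_comp_quad sB sP) sA)) sBA sBA
  (eqdeg_comp sAPB sAPB (op_comp_quad sA sB) (op_comp_quad (op_comp_quad sB sP) sA)
    (fun v u _ => erefl) eAB) (fun v u _ => erefl).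
have -> : op_comp (op_comp (op_comp (op_comp A' P') B') (op_comp A B)) (op_comp B' A') =
    op_comp (op_comp A' P') B'.
  rewrite -(op_compA sAPB (op_comp_quad sA sB) sBA).
  rewrite -(op_compA sA sB sBA) (op_compA sB sB' sA') BB' op_comp_idl AA'.
  by rewrite op_comp_idr.
have -> : op_comp (op_comp (op_comp (op_comp A' P') B')
      (op_comp (op_comp B P) A)) (op_comp B' A') = op_comp B' A'.
  rewrite -(op_compA (op_comp_quad sA' sP') sB' (op_comp_quad (op_comp_quad sB sP) sA)).
  rewrite -(op_compA sB sP sA) (op_compA sB' sB (op_comp_quad sP sA)) B'B op_comp_idl.
  rewrite -(op_compA sA' sP' (op_comp_quad sP sA)) (op_compA sP' sP sA) P'P op_comp_idl.
  by rewrite A'A op_comp_idl.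
exact: eqdeg_sym.
Qed.

(** Exchanging x and y carries S_l to the inverse of T_l, so it maps the
    factorization for (l1, l2) to the inverse of the one for (l2, l1). *)
Lemma op_factorization_swap l1 l2 (c : int * int -> fps K) : normalized c ->
  op_factorization l1 l2 c -> op_factorization l2 l1 (c \o swap).
Proof.
move=> c0 fact_c S T k; rewrite {}/S {}/T.
have [s [ps ss triv eqs]] := fact_c k.
have F0 l : (fps_1T K ^+ l) 0%N = 1 by apply: fps_1TX0.
have cop10 : coprimez (1 : int, 0 : int).1 (1 : int, 0 : int).2 by [].
have cop01 : coprimez (0 : int, 1 : int).1 (0 : int, 1 : int).2 by [].
have swR := swap_reflection; have [_ swK _] := swR.
have hs : all ray_dir s by apply: sub_all ps => w; apply: quad_primitive_ray.
have ps' : all quad_primitive (map swap s).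
  by rewrite all_map; apply: sub_all ps => w /=; rewrite swap_primitive.
have hs' : all ray_dir (map swap s) by apply: sub_all ps' => w; apply: quad_primitive_ray.
exists (rev (map swap s)); split.
- by rewrite all_rev.
- rewrite rev_sorted sorted_map; apply: sub_sorted ss => v w.
  by rewrite /slope_gt /= mulrC [X in _ < X]mulrC.
- move=> w i pw ws i0 ik; apply: (triv (swap w) i _ _ i0).
  + by rewrite swap_primitive.
  + by apply: contra ws => ws; rewrite mem_rev; apply/mapP; exists (swap w).
  + by rewrite /= addrC.
have cs0 : normalized (c \o swap) by move=> w; apply: c0.
have [PP' P'P] := ray_prod_rev cs0 hs'.
have E := eqdeg_conj_swap (op_conj_ray swR cop10 cop01 (F0 l1))
  (op_conj_ray swR cop01 cop10 (F0 l2)) (ray_prod_conj swR c0 hs hs') eqs.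
have [T1 T2] := ray_op_inv cop01 (F0 l1).
have [S1 S2] := ray_op_inv cop10 (F0 l2).
have hr : all ray_dir (rev (map swap s)) by rewrite all_rev.
have q01 : quad (0, 1) by []; have q10 : quad (1, 0) by [].
exact: (op_comm_inv (ray_op_quad q01) (ray_op_quad q01) (ray_op_quad q10)
  (ray_op_quad q10) (ray_prod_quad hs') (ray_prod_quad hr) T2 T1 S2 S1 P'P E).
Qed.

End Swap.

Theorem op_factorization_sym (K : numFieldType) l1 l2 (c : int * int -> fps K) w :
    normalized c -> op_factorization l1 l2 c -> quad_primitive w ->
  (quad_primitive (shear l1 w) -> c w = c (shear l1 w)) /\
  (quad_primitive (swap (shear l2 (swap w))) -> c w = c (swap (shear l2 (swap w)))).
Proof.
move=> c0 fact_c pw; split=> pw'.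
  exact: (op_factorization_shear c0 fact_c erefl erefl erefl erefl pw pw').
have [_ swK _] := swap_reflection.
have cs0 : normalized (c \o swap) by move=> x; apply: c0.
have := op_factorization_shear cs0 (op_factorization_swap c0 fact_c)
  erefl erefl erefl erefl (w := swap w).
by rewrite /= swK; apply; rewrite -swap_primitive ?swK.
Qed.

(** * From automorphisms to operators *)

Section Laurent.
Variable K : fieldType.
Implicit Types (g : laurent K) (m u : int * int).

Lemma mcoeff_lterm (a : K) m u : (lterm a m)@_u = if m == u then a else 0.
Proof. by rewrite /lterm mcoeffU; case: eqP; rewrite ?mulr1n ?mulr0n. Qed.

Lemma lterm0 m : lterm (0 : K) m = 0.
Proof. exact: monalgU0. Qed.

Lemma ltermM (a b : K) m u : lterm a m * lterm b u = lterm (a * b) (m + u).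
Proof. exact: lmul_term. Qed.

Lemma lterm_sum g : g = \sum_(m <- msupp g) lterm g@_m m.
Proof. exact: monalgE. Qed.

Lemma mcoeff_ltermM (a : K) m g u : (lterm a m * g)@_u = a * g@_(u - m).
Proof.
rewrite {1}(lterm_sum g) mulr_sumr raddf_sum /=.
have E x : (lterm a m * lterm g@_x x)@_u = if x == u - m then a * g@_x else 0.
  by rewrite ltermM mcoeff_lterm -[x == _](inj_eq (addrI m)) [m + (_ - _)]addrC subrK.
rewrite (eq_bigr _ (fun x _ => E x)).
have [umg|umg] := boolP (u - m \in msupp g).
  rewrite (big_fsetD1 (u - m) umg) /= eqxx big_seq big1 ?addr0 // => x.
  by rewrite !inE => /andP[/negbTE -> _].
rewrite (mcoeff_outdom umg) mulr0 big_seq big1 // => x xg.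
by case: eqP => // e; rewrite -e xg in umg.
Qed.

Lemma laurentP g1 g2 : (forall u, g1@_u = g2@_u) -> g1 = g2.
Proof. by move=> h; apply/malgP. Qed.

End Laurent.

Section Tring.
Variable K : fieldType.
Implicit Types (F G : tring K) (u v w x : int * int).

(** The monomial z^v. The definition is locked, as is that of ray_series: the
    products of power series must not unfold during unification. *)
Definition xyv : int * int -> tring K := locked (fun v => fpsC (lterm 1 v)).

Lemma xyvC v : xyv v = fpsC (lterm 1 v).
Proof. by rewrite /xyv -lock. Qed.

Lemma xy_xyv (a b : int) : xy a b = xyv (a, b).
Proof. by rewrite xyvC. Qed.

Lemma fpsCM (L : comNzRingType) (a : L) (F : fps L) n : (fpsC a * F) n = a * F n.
Proof.
rewrite fpsM big_ord_recl /= subn0 big1 ?addr0 // => i _.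
by rewrite /= mul0r.
Qed.

Lemma fpsTXM (L : comNzRingType) k (F : fps L) n :
  (fpsT ^+ k * F) n = if (k <= n)%N then F (n - k)%N else 0.
Proof.
elim: k n => [|k IH] n; first by rewrite expr0 mul1r subn0.
rewrite exprS -mulrA fpsM; case: n => [|n].
  by rewrite big_ord1 /= mul0r.
have T0 : @fpsT L 0%N = 0 by [].
have T1 : @fpsT L 1%N = 1 by [].
have T2 i : @fpsT L i.+2 = 0 by [].
rewrite !big_ord_recl big1 => [|i _]; last by rewrite T2 mul0r.
by rewrite T0 T1 mul0r add0r mul1r addr0 lift0 subSS subn0 IH ltnS subSS.
Qed.

Lemma tringCM (a : laurent K) F n : ((fpsC a : tring K) * F) n = a * F n.
Proof. exact: fpsCM. Qed.

Lemma ttXM k F n : (tt ^+ k * F) n = if (k <= n)%N then F (n - k)%N else 0.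
Proof. exact: fpsTXM. Qed.

Lemma tringP F G : (forall n, F n = G n) -> F = G.
Proof. exact: fpsP. Qed.

Lemma tringD F G n : (F + G) n = F n + G n.
Proof. by []. Qed.

Lemma tring_sum I (r : seq I) (P : pred I) (F : I -> tring K) n :
  (\sum_(i <- r | P i) F i) n = \sum_(i <- r | P i) F i n.
Proof. exact: fps_sum. Qed.

Lemma xyvE v n : xyv v n = if n == 0%N then lterm 1 v else 0.
Proof. by rewrite xyvC. Qed.

Lemma xyv_coef v n u : (xyv v n)@_u = ((n == 0%N) && (v == u))%:R.
Proof. by rewrite xyvE; case: eqP => _; rewrite ?mcoeff0 // mcoeff_lterm; case: eqP. Qed.

Lemma xyvM_coef v F n u : ((xyv v * F) n)@_u = (F n)@_(u - v).
Proof. by rewrite xyvC tringCM mcoeff_ltermM mul1r. Qed.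

Lemma xyvD v w : xyv (v + w) = xyv v * xyv w.
Proof.
apply: tringP => n; rewrite (xyvC v) tringCM (xyvE w n) (xyvE (v + w) n).
case: eqP => _; last by rewrite mulr0.
by rewrite ltermM mulr1.
Qed.

Lemma xyv0 : xyv 0 = 1.
Proof. by rewrite xyvC. Qed.

Lemma xyv_unit v : xyv v \is a GRing.unit.
Proof. by apply/unitrPr; exists (xyv (- v)); rewrite -xyvD subrr xyv0. Qed.

Lemma xyv_expz v (k : int) : xyv v ^ k = xyv (v *~ k).
Proof.
have E (n : nat) : xyv v ^+ n = xyv (v *+ n).
  by elim: n => [|n IH]; rewrite ?expr0 ?mulr0n ?xyv0 // exprS IH mulrS xyvD.
case: (intP k) => [|n|n]; first by rewrite expr0z mulr0z xyv0.
  exact: E.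
rewrite -exprnN E; apply: (mulrI (xyv_unit (v *+ n.+1))).
by rewrite mulrV ?xyv_unit // -xyvD mulrNz subrr xyv0.
Qed.

Lemma xyv_split v : xyv v = xx ^ v.1 * yy ^ v.2.
Proof.
rewrite /xx /yy !xy_xyv (xyv_expz (1, 0)) (xyv_expz (0, 1)) -xyvD; congr xyv.
case: v => a b; rewrite /= -[a]intz -[b]intz.
have E (p q : int) (k : int) : (p, q) *~ k = (p * k, q * k).
  have En (n : nat) : (p, q) *+ n = (p * n%:Z, q * n%:Z).
    by rewrite natmul_pair /= -[X in X *+ _]mulr1 -mulrnAr natz -[X in (_, X *+ _)]mulr1
      -mulrnAr natz.
  case: (intP k) => [|n|n]; first by rewrite mulr0z !mulr0.
    exact: En.
  by rewrite mulrNz -[_ *~ _]/((p, q) *+ n.+1) En !mulrN.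
rewrite !E /= !mul1r !mul0r; congr (_, _) => /=; rewrite ?addr0 ?add0r //.
Qed.

Lemma taut_tt (phi : taut K) : phi tt = tt.
Proof.
have -> : tt = tscalar (fpsT : fps K); last exact: taut_scalar.
by apply: tringP => n /=; case: (n == 1%N); rewrite ?lterm0.
Qed.

Lemma tscalarC (a : K) : tscalar (fpsC a) = fpsC (lterm a 0) :> tring K.
Proof. by apply: tringP => i /=; case: (i == 0)%N; rewrite ?lterm0. Qed.

Lemma fpsC_lterm (a : K) m : fpsC (lterm a m) = tscalar (fpsC a) * xyv m.
Proof.
rewrite tscalarC.
apply: tringP => n; rewrite tringCM (xyvE m n).
rewrite [LHS](_ : _ = if n == 0%N then lterm a m else 0) //.
by case: (n == 0)%N; rewrite ?mulr0 // ltermM mulr1 add0r.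
Qed.

Lemma fpsC_sum (L : comNzRingType) I (r : seq I) (F : I -> L) :
  fpsC (\sum_(i <- r) F i) = \sum_(i <- r) fpsC (F i).
Proof.
apply: fpsP => n; rewrite fps_sum /=; case: (n == 0)%N => //.
by rewrite big1.
Qed.

Lemma tautD (phi : taut K) F G : phi (F + G) = phi F + phi G.
Proof. exact: rmorphD. Qed.

Lemma tautM (phi : taut K) F G : phi (F * G) = phi F * phi G.
Proof. exact: rmorphM. Qed.

Lemma tautXn (phi : taut K) F n : phi (F ^+ n) = phi F ^+ n.
Proof. exact: rmorphXn. Qed.

Lemma taut_sum (phi : taut K) I (r : seq I) (F : I -> tring K) :
  phi (\sum_(i <- r) F i) = \sum_(i <- r) phi (F i).
Proof. exact: rmorph_sum. Qed.

(** An automorphism is t-adically continuous and K[[t]]-linear, so it is given by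
    its values on the monomials. *)
Lemma taut_coef (phi : taut K) F n u : (phi F n)@_u =
  \sum_(i < n.+1) \sum_(x <- msupp (F i)) (F i)@_x * (phi (xyv x) (n - i)%N)@_u.
Proof.
pose H : tring K := FPS (fun j => F (j + n.+1)%N).
have FE : F = \sum_(i < n.+1) tt ^+ i * fpsC (F i) + tt ^+ n.+1 * H.
  apply: tringP => j; rewrite tringD tring_sum ttXM.
  rewrite (eq_bigr (fun i : 'I_n.+1 => if i == j :> nat then F j else 0)); last first.
    move=> i _; rewrite ttXM /=; case: ltngtP => // [ij|->]; last by rewrite subnn eqxx.
    by rewrite subn_eq0 leqNgt ij.
  have [nj|nj] := leqP n.+1 j.
    rewrite big1 ?add0r /= ?subnK // => i _; case: eqP => // e.
    by have := ltn_ord i; rewrite e ltnNge nj.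
  rewrite (bigD1 (Ordinal nj)) //= eqxx big1 ?addr0 // => i /negbTE.
  by rewrite -val_eqE /= => ->.
rewrite {1}FE tautD tautM tautXn taut_sum taut_tt tringD ttXM ltnn addr0.
rewrite tring_sum raddf_sum /=; apply: eq_bigr => i _.
rewrite tautM tautXn taut_tt ttXM -ltnS ltn_ord.
rewrite {1}(lterm_sum (F i)) fpsC_sum taut_sum tring_sum raddf_sum /=.
apply: eq_bigr => x _; rewrite fpsC_lterm tautM taut_scalar.
by rewrite tscalarC tringCM mcoeff_ltermM subr0.
Qed.

Lemma taut_eqmodt (phi : taut K) k F G : eqmodt k F G -> eqmodt k (phi F) (phi G).
Proof.
move=> FG n nk; apply: laurentP => u; rewrite !taut_coef; apply: eq_bigr => i _.
by rewrite FG // (leq_trans _ nk) // ltn_ord.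
Qed.

(** The operator A represents phi when phi maps z^v to the sum over u of
    A v u t^{|u - v|} z^u, where |.| is the total degree: the power of t is
    determined by the monomial, so it can be forgotten. *)
Definition op_of (A : int * int -> int * int -> K) (phi : tring K -> tring K) :=
  op_supp quad A /\ forall v n u,
    (phi (xyv v) n)@_u = if opdeg 1 (u - v) == n%:Z then A v u else 0.

Lemma op_of_id : op_of op_id id.
Proof.
split=> [|v n u]; first exact: op_id_quad.
rewrite xyv_coef /op_id; case: (eqVneq v u) => [->|vu].
  by rewrite subrr andbT /opdeg /= mulr0 addr0; case: n.
by rewrite andbF if_same.
Qed.

Lemma op_of_comp A B (phi : taut K) (psi : tring K -> tring K) :
  op_of A phi -> op_of B psi -> op_of (op_comp A B) (phi \o psi).
Proof.
move=> [sA hA] [sB hB]; split; first exact: op_comp_quad.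
move=> v n u; rewrite /= taut_coef.
pose f (i : nat) x := (if opdeg 1 (x - v) == i%:Z then B v x else 0) *
  (if opdeg 1 (u - x) == (n - i)%N%:Z then A x u else 0).
have fE (i : 'I_n.+1) :
    \sum_(x <- msupp (psi (xyv v) i)) (psi (xyv v) i)@_x * (phi (xyv x) (n - i)%N)@_u =
    \sum_(x <- box v u) f i x.
  transitivity (\sum_(x \in [set: int * int]%classic) f i x).
    rewrite (fsbigTE (msupp (psi (xyv v) i))) => [|x xs].
      by apply: eq_bigr => x _; rewrite hB hA.
    by rewrite /f -hB mcoeff_outdom ?mul0r.
  apply: fsbigTE => x; apply: contraNeq; rewrite /f => fx.
  have [] : B v x != 0 /\ A x u != 0.
    by split; apply: contraNneq fx => ->; rewrite if_same ?mul0r ?mulr0.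
  by move=> /sB ? /sA ?; apply: mem_box.
rewrite (eq_bigr _ (fun i _ => fE i)) exchange_big /=.
have fx x : \sum_(i < n.+1) f i x = if opdeg 1 (u - v) == n%:Z then B v x * A x u else 0.
  have [Bx|Bx] := eqVneq (B v x) 0.
    by rewrite Bx mul0r if_same big1 // => i _; rewrite /f Bx if_same mul0r.
  have [Ax|Ax] := eqVneq (A x u) 0.
    by rewrite Ax mulr0 if_same big1 // => i _; rewrite /f Ax if_same mulr0.
  have dB := opdeg_ge0 1 (sB _ _ Bx); have dA := opdeg_ge0 1 (sA _ _ Ax).
  rewrite (opdegB 1 v x u) /f.
  move: dB dA; set p := opdeg 1 (x - v); set q := opdeg 1 (u - x) => dB dA.
  case: eqP => pq; last first.
    rewrite big1 // => i _; case: eqP => e1; last by rewrite mul0r.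
    case: eqP => e2; last by rewrite mulr0.
    by case: pq; rewrite e1 e2 -PoszD subnKC // -ltnS.
  have pn : (`|p| < n.+1)%N by lia.
  rewrite (bigD1 (Ordinal pn)) //= gez0_abs // eqxx ifT; last by lia.
  rewrite big1 ?addr0 // => i; rewrite -val_eqE /= => ip.
  by rewrite ifN ?mul0r //; apply: contra ip; lia.
rewrite (eq_bigr _ (fun x _ => fx x)) /=; case: eqP => _; last by rewrite big1.
by rewrite op_comp_box.
Qed.

Lemma op_of_eqdeg k A B (phi psi : tring K -> tring K) :
  op_of A phi -> op_of B psi ->
  (forall F, eqmodt k (phi F) (psi F)) -> eqdeg 1 k A B.
Proof.
move=> [sA hA] [sB hB] e v u vu.
have [q|nq] := boolP (quad (u - v)); last by rewrite (op_supp_eq0 sA) // (op_supp_eq0 sB).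
have d0 := opdeg_ge0 1 q; set n := `|opdeg 1 (u - v)%R|%N.
have nE : opdeg 1 (u - v) = n by rewrite /n gez0_abs.
have nk : (n < k)%N by rewrite -ltz_nat -nE.
have := hA v n u; have := hB v n u; rewrite nE eqxx => <- <-.
by rewrite (e _ _ nk).
Qed.

End Tring.

Lemma sum_dvd (V : nmodType) d j (h : nat -> V) : (0 < d)%N ->
  \sum_(i < (j * d).+1 | (d %| i)%N) h i = \sum_(i < j.+1) h (i * d)%N.
Proof.
move=> d0; have lt_i (i : 'I_j.+1) : (i * d < (j * d).+1)%N.
  by rewrite ltnS leq_mul2r leq_ord orbT.
rewrite (reindex_onto (fun i : 'I_j.+1 => inord (i * d) : 'I_(j * d).+1)
                      (fun i => inord (i %/ d))) /=.
  apply: eq_big => i; last by rewrite inordK.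
  by rewrite inordK // dvdn_mull //= mulnK // inord_val eqxx.
move=> i di; have lt_ij : (i %/ d < j.+1)%N.
  by rewrite ltnS -(leq_pmul2r d0) divnK // -ltnS.
by apply/val_inj; rewrite /= (inordK lt_ij) divnK // inordK.
Qed.

Lemma sum_pick (V : nmodType) d N (h : nat -> V) : (0 < d)%N ->
  \sum_(n < N.+1) (if N == (d * n)%N then h n else 0) =
  if (d %| N)%N then h (N %/ d)%N else 0.
Proof.
move=> d0; have [/dvdnP[j Nj]|ndN] := boolP (d %| N)%N; last first.
  by rewrite big1 // => i _; case: eqP => // e; rewrite e dvdn_mulr in ndN.
have jN : (j < N.+1)%N by rewrite ltnS Nj leq_pmulr.
rewrite (bigD1 (Ordinal jN)) //= big1 ?addr0 => [|i].
  by rewrite Nj mulnK // mulnC eqxx.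
rewrite -val_eqE /= => ij; case: eqP => // /eqP.
by rewrite {1}Nj mulnC eqn_pmul2l // eq_sym (negbTE ij).
Qed.

Section RaySeries.
Variable K : fieldType.
Implicit Types (F G : fps K) (u v w : int * int).

(** The total degree of w, as a natural number. *)
Definition wdeg w : nat := `|opdeg 1 w|%N.

(** The series F((tx)^a (ty)^b), where w = (a, b). *)
Definition ray_series : int * int -> fps K -> tring K := locked (fun w F =>
  FPS (fun n => if (wdeg w %| n)%N
                then lterm (F (n %/ wdeg w)%N) (w *+ (n %/ wdeg w)) else 0)).

Lemma ray_seriesE w F n : ray_series w F n =
  if (wdeg w %| n)%N then lterm (F (n %/ wdeg w)%N) (w *+ (n %/ wdeg w)) else 0.
Proof. by rewrite /ray_series -lock. Qed.

Lemma ray_series1 w : (0 < wdeg w)%N -> ray_series w 1 = 1.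
Proof.
move=> d0; apply: tringP => n; rewrite ray_seriesE fps1.
case: n => [|n]; first by rewrite dvdn0 div0n mulr0n.
rewrite [RHS](_ : _ = 0) //; case: ifP => // dn.
have -> : (n.+1 %/ wdeg w == 0)%N = false.
  by rewrite eqn0Ngt divn_gt0 // dvdn_leq.
exact: lterm0.
Qed.

Lemma ray_seriesM w F G : (0 < wdeg w)%N ->
  ray_series w (F * G) = ray_series w F * ray_series w G.
Proof.
move=> d0; apply: tringP => n; rewrite ray_seriesE.
have -> : (ray_series w F * ray_series w G) n =
    \sum_(i < n.+1) ray_series w F i * ray_series w G (n - i)%N by [].
set d := wdeg w in d0 *.
have [/dvdnP[j nj]|ndn] := boolP (d %| n)%N; last first.
  rewrite big1 // => i _; rewrite (ray_seriesE w F i) (ray_seriesE w G (n - i)) -/d.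
  have [di|_] := boolP (d %| i)%N; last by rewrite mul0r.
  rewrite ifN ?mulr0 //; apply: contra ndn => dni.
  by rewrite -(subnK (leq_ord i)) dvdn_add.
rewrite nj mulnK // fpsM.
rewrite (big_morph (lterm^~ (w *+ j)) (fun a b => monalgUD _ a b) (lterm0 K _)).
have E (i : 'I_(j * d).+1) :
    ray_series w F i * ray_series w G (j * d - i)%N =
    if (d %| i)%N then
      lterm (F (i %/ d)%N * G (j - i %/ d)%N) (w *+ j) else 0.
  rewrite (ray_seriesE w F i) (ray_seriesE w G (j * d - i)) -/d.
  have [/dvdnP[k ik]|_] := boolP (d %| i)%N; last by rewrite mul0r.
  have kj : (k <= j)%N by rewrite -(leq_pmul2r d0) -ik -ltnS.
  by rewrite ik -mulnBl dvdn_mull // !mulnK // ltermM -mulrnDr subnKC.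
rewrite (eq_bigr _ (fun i _ => E i)) -big_mkcond /=.
rewrite (sum_dvd j (fun i => lterm (F (i %/ d)%N * G (j - i %/ d)%N) (w *+ j)) d0).
by apply: eq_bigr => i _; rewrite mulnK.
Qed.

Lemma ray_series_expz w F (k : int) : (0 < wdeg w)%N -> F 0%N = 1 ->
  ray_series w F \is a GRing.unit /\ ray_series w F ^ k = ray_series w (F ^ k).
Proof.
move=> d0 F0; have FV := fps_unit F0.
have uE : ray_series w F \is a GRing.unit.
  by apply/unitrPr; exists (ray_series w F^-1); rewrite -ray_seriesM // mulrV // ray_series1.
split=> //; have E (n : nat) : ray_series w F ^+ n = ray_series w (F ^+ n).
  elim: n => [|n IH]; first by rewrite !expr0 ray_series1.
  by rewrite !exprS IH ray_seriesM.
case: (intP k) => [|n|n]; first by rewrite !expr0z ray_series1.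
  exact: E.
rewrite -!exprnN; apply: (mulrI (unitrX n.+1 uE)).
rewrite mulrV ?unitrX // E -ray_seriesM // mulrV ?unitrX //.
by rewrite ray_series1.
Qed.

Lemma wdeg_gt0 w : quad w -> w != 0 -> (0 < wdeg w)%N.
Proof.
case: w => a b /andP[/= a0 b0] ab; rewrite /wdeg /opdeg /= mul1r absz_gt0.
by apply: contra ab; rewrite paddr_eq0 // => /andP[/eqP -> /eqP ->].
Qed.

Lemma opdegMn e w n : opdeg e (w *+ n) = n%:Z * opdeg e w.
Proof. by rewrite natmul_pair /opdeg /= -(mulr_natl w.1) -(mulr_natl w.2) natz; ring. Qed.

(** This and the next two lemmas show that theta_{(a,b),f} multiplies z^v by
    f^det((a, b), v). *)
Lemma twist_expz (R : unitRingType) (x y f : R) (a b i j : int) :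
    commutative (@GRing.mul R) ->
    x \is a GRing.unit -> y \is a GRing.unit -> f \is a GRing.unit ->
  (x * f ^ (- b)) ^ i * (y * f ^ a) ^ j = x ^ i * y ^ j * f ^ (a * j - b * i).
Proof.
move=> mulC ux uy uf; have uX k := unitrXz k uf.
rewrite (exprMz_comm i ux (uX _) (mulC _ _)) (exprMz_comm j uy (uX _) (mulC _ _)).
rewrite !exprz_exp -!mulrA; congr (_ * _).
by rewrite mulC -mulrA -(exprzDr uf) mulNr.
Qed.

Lemma tautXz (phi : taut K) (g : tring K) (k : int) :
  g \is a GRing.unit -> phi (g ^ k) = phi g ^ k.
Proof. exact: rmorphXz. Qed.

Lemma taut_xyv (phi : taut K) (f : tring K) (a b : int) : f \is a GRing.unit ->
    phi xx = xx * f ^ (- b) -> phi yy = yy * f ^ a ->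
  forall v, phi (xyv K v) = xyv K v * f ^ det (a, b) v.
Proof.
move=> uf fx fy v.
have ux : (xx : tring K) \is a GRing.unit by rewrite /xx xy_xyv; apply: xyv_unit.
have uy : (yy : tring K) \is a GRing.unit by rewrite /yy xy_xyv; apply: xyv_unit.
have e : phi (xyv K v) = phi xx ^ v.1 * phi yy ^ v.2.
  by rewrite xyv_split tautM; congr (_ * _); apply: tautXz.
have e2 := congr2 (fun g h : tring K => g ^ v.1 * h ^ v.2) fx fy.
have e3 : xyv K v * f ^ det (a, b) v = xx ^ v.1 * yy ^ v.2 * f ^ (a * v.2 - b * v.1).
  rewrite (xyv_split K v).
  have -> : det (a, b) v = a * v.2 - b * v.1 by [].
  reflexivity.
have e4 := twist_expz a b v.1 v.2 (@mulrC (tring K)) ux uy uf.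
rewrite e e2 e3.
exact: e4.
Qed.

Lemma op_of_theta w F (f : tring K) (phi : taut K) :
    quad w -> coprimez w.1 w.2 -> F 0%N = 1 -> f = ray_series w F ->
    phi xx = xx * f ^ (- w.2) -> phi yy = yy * f ^ w.1 ->
  op_of (ray_op w F) phi.
Proof.
move=> qw cop F0 fE fx fy; have w0 := coprimez_neq0 cop.
have d0 := wdeg_gt0 qw w0; have [uf fX] := ray_series_expz (det w (0, 0)) d0 F0.
rewrite -fE in uf; have phiv v : phi (xyv K v) = xyv K v * ray_series w (F ^ det w v).
  have [_ <-] := ray_series_expz (det w v) d0 F0; rewrite -fE.
  exact: taut_xyv uf fx fy v.
split; first exact: ray_op_quad.
move=> v n u; rewrite phiv xyvM_coef ray_seriesE.
have wdE : opdeg 1 w = wdeg w by rewrite /wdeg gez0_abs // opdeg_ge0.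
case: (rayP w v u) => [j ->|off].
  rewrite [v + _]addrC addrK opdegMn wdE -PoszM eqz_nat.
  have [<-|ne] := eqVneq (j * wdeg w)%N n.
    by rewrite dvdn_mull // mulnK // mcoeff_lterm eqxx [_ + v]addrC (ray_opE F v j cop).
  case: ifP => dn; last by rewrite mcoeff0.
  rewrite mcoeff_lterm (inj_eq (mulrIn_pair w0)); case: eqP => // e.
  by move: ne; rewrite -e divnK // eqxx.
rewrite (ray_op0 F off) if_same; case: ifP => _; last by rewrite mcoeff0.
rewrite mcoeff_lterm; case: eqP => // e; case: (off (n %/ wdeg w)%N).
by rewrite e addrC subrK.
Qed.

Lemma tring1 n : (1 : tring K) n = if n == 0%N then lterm 1 0 else 0.
Proof. by []. Qed.

Lemma ray_series_1T w n : (0 < wdeg w)%N ->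
  ray_series w (fps_1T K ^+ n) = (1 + tt ^+ wdeg w * xyv K w) ^+ n.
Proof.
move=> d0; have E1 : ray_series w (fps_1T K) = 1 + tt ^+ wdeg w * xyv K w.
  apply: tringP => i; rewrite ray_seriesE tringD ttXM xyvE.
  rewrite tring1.
  case: (posnP i) => [->|i0].
    by rewrite dvdn0 div0n mulr0n leqNgt d0 addr0 /= addr0.
  rewrite add0r /fps_1T; case: (ltngtP i (wdeg w)) => iw.
  - by rewrite gtnNdvd.
  - case: ifP => dn; rewrite ?subn_eq0 leqNgt iw //=.
    have : (1 < i %/ wdeg w)%N by rewrite ltn_divRL // mul1n.
    by case: (i %/ wdeg w)%N => [|[|k]] //= _; rewrite addr0 lterm0.
  - by rewrite iw dvdnn divnn d0 subnn /= add0r.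
elim: n => [|n IH]; first by rewrite !expr0 ray_series1.
rewrite (exprS (fps_1T K) n) (ray_seriesM _ _ d0) IH E1.
exact: esym (exprS _ _).
Qed.

Lemma expr_mul_split (R : comPzRingType) (t x y : R) p q :
  (t * x) ^+ p * (t * y) ^+ q = t ^+ (p + q) * (x ^+ p * y ^+ q).
Proof. by rewrite !exprMn exprD mulrACA. Qed.

Lemma xyvXn w n : xyv K w ^+ n = xyv K (w *+ n).
Proof. exact: (xyv_expz K w n%:Z). Qed.

Lemma is_reduced_ray_series w (f : tring K) (fs : fps rat) : in_quadrant w ->
  is_reduced_series w f fs -> f = ray_series w (fps_map ratr fs).
Proof.
move=> qw; have qw' : quad w by case/andP: qw => h1 h2; rewrite /quad !ltW.
have d0 : (0 < wdeg w)%N.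
  by rewrite wdeg_gt0 //; apply/eqP => e; rewrite e in qw.
have wdE : wdeg w = (`|w.1| + `|w.2|)%N.
  by case/andP: qw => h1 h2; rewrite /wdeg /opdeg mul1r; lia.
rewrite /is_reduced_series => ->; set U := _ * _.
have U1 : U = tt ^+ wdeg w * xyv K w.
  have [p pE] : exists p : nat, w.1 = p%:Z.
    by exists `|w.1|%N; case/andP: qw => ? _; lia.
  have [q qE] : exists q : nat, w.2 = q%:Z.
    by exists `|w.2|%N; case/andP: qw => _ ?; lia.
  rewrite (xyv_split K w) wdE /U pE qE !absz_nat.
  exact: (expr_mul_split (tt : tring K) xx yy p q).
have UE n : U ^+ n = tt ^+ (wdeg w * n) * xyv K (w *+ n).
  by rewrite U1 exprM -xyvXn; apply: exprMn.
apply: tringP => N; rewrite ray_seriesE.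
have -> : series_eval fs U N =
    \sum_(n < N.+1) (ratr (fs n) : K) *: (U ^+ n : tring K) N by [].
have E (n : nat) : (ratr (fs n) : K) *: (U ^+ n : tring K) N =
    if N == (wdeg w * n)%N then lterm (ratr (fs n)) (w *+ n) else 0.
  rewrite UE ttXM xyvE; case: (ltngtP N (wdeg w * n)%N) => h.
  - by rewrite scaler0.
  - by rewrite subn_eq0 leqNgt h /= scaler0.
  - rewrite h subnn eqxx; apply: laurentP => u.
    rewrite mcoeffZ.
    have e1 := mcoeff_lterm (1 : K) (w *+ n) u.
    have e2 := mcoeff_lterm (ratr (fs n) : K) (w *+ n) u.
    by rewrite [X in _ * X = _]e1 e2; case: eqP => _; rewrite ?mulr1 ?mulr0.
rewrite (eq_bigr _ (fun (n : 'I_N.+1) _ => E n)).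
exact: (sum_pick N (fun n => lterm (ratr (fs n)) (w *+ n)) d0).
Qed.

End RaySeries.

Section Factorization.
Variable K : numFieldType.
Implicit Types (F G : fps K) (v w : int * int).

Lemma quad_primitive_quad w : quad_primitive w -> quad w.
Proof. by move=> pw; apply/ray_dir_quad/quad_primitive_ray. Qed.

Lemma tv_function_coef0 a b (f : tring K) : tv_function a b f -> f 0%N = lterm 1 0.
Proof.
case=> g ->; rewrite -mulrA -[tt in X in _ + X]expr1 tringD tring1 ttXM.
exact: addr0.
Qed.

Lemma ray_series_coef0 w F : ray_series w F 0%N = lterm (F 0%N) 0.
Proof. by rewrite ray_seriesE dvdn0 div0n mulr0n. Qed.

Lemma lterm_inj (a b : K) m : lterm a m = lterm b m -> a = b.
Proof.
move=> e; have ea := mcoeff_lterm a m m; have eb := mcoeff_lterm b m m.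
by rewrite eqxx in ea eb; rewrite -ea e.
Qed.

Lemma op_of_comp_seq (c : int * int -> fps K) (theta : int * int -> taut K) s B
    (psi : tring K -> tring K) : all ray_dir s -> op_of B psi ->
    (forall w, w \in s -> op_of (ray_op w (c w)) (theta w)) ->
  op_of (op_comp (ray_prod c s) B) (comp_seq theta s \o psi).
Proof.
move=> + hB; elim: s => [_ _|w s IH /andP[hw hs] h].
  by rewrite [ray_prod _ _](_ : _ = op_id) // op_comp_idl.
have rw := h w (mem_head w s).
rewrite ray_prod_cons -(op_compA rw.1 (ray_prod_quad hs) hB.1).
apply: (op_of_comp rw (psi := comp_seq theta s \o psi)); apply: IH hs _ => x xs.
by apply: h; rewrite in_cons xs orbT.
Qed.

(** If theta_{w,F} is trivial modulo t^k, so is F: consider the image of x. *)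
Lemma theta_trivial w F (phi : taut K) k : quad_primitive w -> F 0%N = 1 ->
    op_of (ray_op w F) phi -> (forall G : tring K, eqmodt k (phi G) G) ->
  forall i : nat, (0 < i)%N -> i%:Z * (w.1 + w.2) < k%:Z -> F i = 0.
Proof.
move=> pw F0 rphi triv i; have hw := quad_primitive_ray pw.
have cop := ray_dir_coprime hw.
have wd : 0 < w.1 + w.2 by case/andP: pw => /andP[? ?] _; rewrite addr_gt0.
have E := op_of_eqdeg rphi (op_of_id K) triv.
have [n] := ubnP i; elim: n i => // n IH i; rewrite ltnS => le_in i0 ik.
have F1 j : (j < i)%N -> F j = (1 : fps K) j.
  case: j => [|j] ji; first exact: etrans F0 (esym (fps1 _ 0)).
  rewrite fps1; apply: IH => //; first exact: leq_trans ji le_in.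
  by apply: lt_trans ik; rewrite ltr_pM2r // ltz_nat.
have D := fps_expz_diff (det w (1, 0)) F0 (fps1 K 0) i0 F1.
have P : (F ^ det w (1, 0)) i = 0.
  rewrite -(ray_opE F (1, 0) i cop) E.
    rewrite /op_id -[X in (X == _)%:R]addr0 (inj_eq (addrI _)) eq_sym.
    by rewrite -(mulr0n w) (inj_eq (mulrIn_pair (coprimez_neq0 cop))) gtn_eqF.
  by rewrite addrC addKr opdegMn /opdeg mul1r.
have Q : (1 : fps K) i = 0 by rewrite fps1 gtn_eqF.
have Q' : ((1 : fps K) ^ det w (1, 0)) i = 0 by apply: etrans Q; rewrite exp1rz.
have aux (x y z t : K) d : x - y = (z - t) *~ d -> x = 0 -> y = 0 -> t = 0 -> z *~ d = 0.
  by move=> e x0 y0 t0; rewrite -[z]subr0 -t0 -e x0 y0 subrr.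
have /eqP := aux _ _ _ _ _ D P Q' Q.
by rewrite mulrz_eq0 (negbTE (det_10_neq0 hw)) orFb => /eqP.
Qed.

Variables (l1 l2 : nat) (f : int * int -> tring K) (fs : int * int -> fps rat).
Hypothesis fact_f : commutator_factorization l1 l2 f.
Hypothesis f_reduced : forall v, quad_primitive v -> is_reduced_series v (f v) (fs v).

(** The one-variable series of the direction w with coefficients in K, extended by
    1 to the vectors that are not primitive directions of the open quadrant. *)
Definition slope_series w : fps K :=
  if quad_primitive w then fps_map ratr (fs w) else 1.

Lemma slope_seriesE w : quad_primitive w -> f w = ray_series w (slope_series w).
Proof.
move=> pw; rewrite /slope_series pw; apply: is_reduced_ray_series.
  by case/andP: pw.
exact: f_reduced.
Qed.

Lemma slope_series_normalized : normalized slope_series.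
Proof.
move=> w; have [pw|npw] := boolP (quad_primitive w); last first.
  by rewrite /slope_series (negbTE npw) fps1.
have [S [T [theta [_ _ th _]]]] := fact_f.
have [tv _ _] := th w pw; apply: (@lterm_inj _ _ 0).
by rewrite -(ray_series_coef0 w) -slope_seriesE // (tv_function_coef0 tv).
Qed.

Lemma commutator_op_factorization : op_factorization l1 l2 slope_series.
Proof.
have c0 := slope_series_normalized.
have [S [T [theta [[_ Sx Sy] [_ Tx Ty] th prod]]]] := fact_f.
have F0 l : (fps_1T K ^+ l) 0%N = 1 by apply: fps_1TX0.
have rS : op_of (ray_op (1, 0) (fps_1T K ^+ l1)) S.
  apply: (op_of_theta (w := (1, 0)) _ _ (F0 l1) _ Sx Sy) => [//|//|].
  have d1 : wdeg (1 : int, 0 : int) = 1%N by [].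
  rewrite (ray_series_1T K l1 (w := (1, 0)) isT) d1 expr1 /xx xy_xyv.
  reflexivity.
have rT : op_of (ray_op (0, 1) (fps_1T K ^+ l2)) T.
  apply: (op_of_theta (w := (0, 1)) _ _ (F0 l2) _ Tx Ty) => [//|//|].
  have d1 : wdeg (0 : int, 1 : int) = 1%N by [].
  rewrite (ray_series_1T K l2 (w := (0, 1)) isT) d1 expr1 /yy xy_xyv.
  reflexivity.
have rth w : quad_primitive w -> op_of (ray_op w (slope_series w)) (theta w).
  move=> pw; have [_ tx ty] := th w pw.
  apply: (op_of_theta (quad_primitive_quad pw) _ (c0 w) (slope_seriesE pw) tx ty).
  by case/andP: pw.
move=> k; have [s [ps ss triv eqs]] := prod k.
exists s; split; [exact: ps | exact: ss | |].
  by move=> w i pw ws; apply: (theta_trivial pw (c0 w) (rth w pw)); apply: triv.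
have hs : all ray_dir s by apply: sub_all ps => w; apply: quad_primitive_ray.
have rPS := op_of_comp_seq hs rS (fun w ws => rth w (allP ps w ws)).
rewrite -(op_compA rT.1 (ray_prod_quad hs) rS.1).
apply: (op_of_eqdeg (op_of_comp rS rT) (op_of_comp rT rPS)) => G.
(* the commutator relation at S G, after applying T *)
have := taut_eqmodt T (eqs (S G)).
by rewrite /= (tautK S) taut_invK.
Qed.

End Factorization.

(** The symmetry over an arbitrary numeric field; only characteristic 0 matters. *)
Theorem slope_symmetry (K : numFieldType) (l1 l2 : nat)
    (f : int * int -> tring K) (fs : int * int -> fps rat) :
  commutator_factorization l1 l2 f ->
  (forall v, quad_primitive v -> is_reduced_series v (f v) (fs v)) ->
  forall a b : int, quad_primitive (a, b) ->
    (in_quadrant (l1%:Z * b - a, b) -> fs (a, b) = fs (l1%:Z * b - a, b)) /\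
    (in_quadrant (a, l2%:Z * a - b) -> fs (a, b) = fs (a, l2%:Z * a - b)).
Proof.
move=> fact_f f_reduced a b pab.
have c0 := slope_series_normalized fact_f f_reduced.
have [sym1 sym2] := op_factorization_sym c0 (commutator_op_factorization fact_f f_reduced) pab.
have descend v w : quad_primitive v -> quad_primitive w ->
    slope_series K fs v = slope_series K fs w -> fs v = fs w.
  move=> pv pw; rewrite /slope_series pv pw => e; apply: fpsP => n.
  have e' : (ratr (fs v n) : K) = ratr (fs w n).
    by have := congr1 (fun F : fps K => F n) e.
  exact: fmorph_inj e'.
have cop : coprimez a b by case/andP: pab.
split=> q.
  have p1 : quad_primitive (shear l1 (a, b)).
    by rewrite /quad_primitive q shear_coprime.
  exact: descend pab p1 (sym1 p1).
have p2 : quad_primitive (swap (shear l2 (swap (a, b)))).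
  rewrite swap_primitive /quad_primitive shear_coprime coprimez_sym cop andbT.
  by case/andP: q => q1 q2; apply/andP.
exact: descend pab p2 (sym2 p2).
Qed.

Theorem theorem7 (R : realType) (l1 l2 : nat)
    (f : int * int -> tring R[i]) (fs : int * int -> fps rat) :
  (0 < l1)%N -> (0 < l2)%N ->
  commutator_factorization l1 l2 f ->
  (forall v, quad_primitive v -> is_reduced_series v (f v) (fs v)) ->
  forall a b : int, quad_primitive (a, b) ->
    (in_quadrant (l1%:Z * b - a, b) -> fs (a, b) = fs (l1%:Z * b - a, b)) /\
    (in_quadrant (a, l2%:Z * a - b) -> fs (a, b) = fs (a, l2%:Z * a - b)).
Proof. by move=> _ _; apply: slope_symmetry. Qed.
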